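(* Fix an integer $n\geq 1$ and let $\frac PQ,\frac ab,\frac ST$ be rational numbers (with $\frac AB<\frac ST$ Farey neighbors) such that $$0\leq \frac AB<\frac PQ < \frac ab < \frac{S_n}{T_n}\leq \frac ST\leq 1,\qquad \frac PQ = \frac{A+S}{B+T},\qquad \frac{S_n}{T_n}:=\frac{(n-1)P+S}{(n-1)Q+T}.$$ Denote the M-sequence of the broken line $BL(\frac PQ,\frac ab,n)$ (in the $01$-convention) by $\theta=0.\overline{\alpha_1\cdots\alpha_b}=0.\overline{W_{\zeta_1}\cdots W_{\zeta_k}}$, where $k\ge1$ and $\zeta_i\in\{S/T,P/Q\}$ for $i=1,\dots,k$ (with $\alpha_1\cdots\alpha_b=W_{\zeta_1}\cdots W_{\zeta_k}$ as words). Let $K(\theta)=\overline{\Omega_1\cdots\Omega_{b-1}*}$ be the kneading sequence of $\theta$, with $\Omega_i\in\{0,1\}$ for $i=1,\dots,b-1$. Then: (a) For $1\le i\le b-1$, $\Omega_i=0$ if and only if $\alpha_{i+1}$ is the first digit of a string $W_{P/Q}^sW_{S/T}$ for some $0\leq s<n$. (b) The numbers $\frac PQ$, $\frac ST$, $\frac ab$ and the M-sequence of $BL(\frac PQ,\frac ab,n)$ can be recovered from the kneading sequence $K(\theta)$; that is, suppose that $\tilde n\geq 1$ is an integer and $\frac{\tilde P}{\tilde Q},\frac{\tilde a}{\tilde b},\frac{\tilde S}{\tilde T}$ are rational numbers (with $\frac{\tilde A}{\tilde B}<\frac{\tilde S}{\tilde T}$ Farey neighbors) such that $$0\leq \frac{\tilde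 A}{\tilde B}<\frac{\tilde P}{\tilde Q} < \frac{\tilde a}{\tilde b} < \frac{(\tilde n-1)\tilde P+\tilde S}{(\tilde n-1)\tilde Q+\tilde T}\leq \frac{\tilde S}{\tilde T}\leq 1,\qquad \frac{\tilde P}{\tilde Q} = \frac{\tilde A+\tilde S}{\tilde B+\tilde T};$$ if the two broken lines $BL(\frac PQ,\frac ab,n)$ and $BL(\frac{\tilde P}{\tilde Q},\frac{\tilde a}{\tilde b},\tilde n)$ have M-sequences (in the $01$-convention) with the same kneading sequence, then $\frac PQ=\frac{\tilde P}{\tilde Q}$, $\frac ST=\frac{\tilde S}{\tilde T}$, $\frac ab=\frac{\tilde a}{\tilde b}$, and their M-sequences coincide.
   Context: Fractions are in lowest terms (with $0=\frac01$, $1=\frac11$). Farey neighbors $\frac AB<\frac ST$ are fractions with $SB-AT=1$; their mediant is $\frac{A+S}{B+T}$. M-sequences ($01$-convention). For rational $0<p/q\le 1$, list in order of increasing $x>0$ the points $(x_i,y_i)$, $i\ge 1$, of the line $y=\frac pq x$ having at least one integer coordinate. Put $k_i=0$ if only $x_i$ is an integer, $k_i=1$ if only $y_i$ is an integer, and write the two symbols $01$ if both are integers. Concatenating gives a periodic binary sequence $\kappa_{01}(p/q)$ of period $p+q$. Replacing each block $01$ in it by $1$ gives a periodic binary sequence, and $\theta_{01}(p/q)=0.\overline{W_{p/q}}$ is the number with this binary expansion, where $W_{p/q}$ is a binary word of length $q$ (in particular $W_{1/1}=1$). The broken line $BL(\frac PQ,\frac ab,n)$ is the graph of $y=\frac PQ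 x$ for $0\le x\le nQ$, $y=\frac ab(x-nQ)+nP$ for $x\ge nQ$. Its M-sequence $\theta_{01}(\frac PQ,\frac ab,n)$ is obtained from this graph by the same procedure; equivalently $\theta_{01}(\frac PQ,\frac ab,n)=0.W_{P/Q}^n\overline{W_{a/b}}$, which is periodic of period $b$ and is a periodic concatenation of words $W_{S/T},W_{P/Q}$. ''$\alpha_{i+1}$ is the first digit of a string $W_{P/Q}^sW_{S/T}$'' means: in the (periodically repeated) decomposition into words $W_{\zeta_1}W_{\zeta_2}\cdots W_{\zeta_k}$, the position $i+1$ is the first position of one of the words $W_{\zeta_j}$, and starting from that word there are $s$ consecutive words $W_{P/Q}$ followed by a word $W_{S/T}$. Kneading sequence. For $\theta\in\mathbb R/\mathbb Z$, $K(\theta)=\Omega_1\Omega_2\cdots$, where $\Omega_i=1$ if $2^{i-1}\theta\bmod1$ lies in the open arc $]\frac\theta2,\frac{\theta+1}2[$, $\Omega_i=0$ if it lies in the complementary open arc $]\frac{\theta+1}2,\frac\theta2[$ of the circle, and $\Omega_i=*$ if it lies in $\{\frac\theta2,\frac{\theta+1}2\}$ (with $\theta\in(0,1)$). *)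

(* Defs.v *)
From HB Require Import structures.
From mathcomp Require Import all_boot all_order all_algebra.
From mathcomp Require Import all_classical all_reals all_analysis.

Set Implicit Arguments.
Unset Strict Implicit.
Unset Printing Implicit Defensive.

Import Order.TTheory GRing.Theory Num.Theory.
Import numFieldNormedType.Exports.

Local Open Scope classical_set_scope.
Local Open Scope ring_scope.

(* Elements of [rat] are automatically in lowest terms: [numq] and [denq]
   return the reduced numerator and the positive reduced denominator. *)

Definition denn (r : rat) : nat := `|denq r|%N.

Definition farey_neighbors (r s : rat) : Prop :=
  r < s /\ numq s * denq r - numq r * denq s = 1.

Definition mediant (r s : rat) : rat :=
  (numq r + numq s)%:~R / (denq r + denq s)%:~R.

(* S_n/T_n = ((n-1)P + S) / ((n-1)Q + T); used only with 1 <= n. *)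
Definition iter_mediant (n : nat) (pq st : rat) : rat :=
  (numq pq *+ n.-1 + numq st)%:~R / (denq pq *+ n.-1 + denq st)%:~R.

Definition BL_data (n : nat) (AB PQ ab ST : rat) : Prop :=
  [/\ (1 <= n)%N,
      farey_neighbors AB ST,
      [/\ 0 <= AB, AB < PQ, PQ < ab & ab < iter_mediant n PQ ST],
      iter_mediant n PQ ST <= ST /\ ST <= 1
    & PQ = mediant AB ST].

(* Infinite sequences are functions on [nat], hence indexed from 0: the
   (i+1)-st term of a sequence u is [u i].  Digits are booleans, with
   [false] for 0 and [true] for 1. *)

Section Mseq.
Variable R : realType.
Implicit Types (f : R -> R) (x : R) (u : nat -> bool).

Definition crossings f : set R :=
  [set x | 0 < x /\ (x \is a Num.int \/ f x \is a Num.int)].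

(* For the graphs considered below, [crossings f] is closed and discrete, so
   that the infimum is a minimum. *)
Definition next_crossing f x : R := inf (crossings f `&` [set y | x < y]).

Definition nth_crossing f (i : nat) : R := iter i.+1 (next_crossing f) 0.

Definition crossing_word f x : seq bool :=
  (if x \is a Num.int then [:: false] else [::]) ++
  (if f x \is a Num.int then [:: true] else [::]).

(* Every crossing contributes at least one symbol, so the first i+1 crossings
   determine the symbol of index i. *)
Definition kappa f (i : nat) : bool :=
  nth false (flatten [seq crossing_word f (nth_crossing f j) | j <- iota 0 i.+1]) i.

(* Replacing every block 01 by 1 amounts to deleting the symbols 0 that are
   immediately followed by 1.  Of two consecutive symbols at most one is
   deleted, so the first 2(i+1) symbols contain at least i+1 remaining ones. *)
Definition collapse01 u (i : nat) : bool :=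
  nth false [seq u j | j <- iota 0 (2 * i.+1)%N & ~~ (~~ u j && u j.+1)] i.

Definition Mdigits f : nat -> bool := collapse01 (kappa f).

Definition binary_number u : R :=
  limn (series (fun i : nat => (u i)%:R / 2 ^+ i.+1 : R)).

Definition line (r : rat) x : R := ratr r * x.

Definition broken_line (PQ ab : rat) (n : nat) x : R :=
  if x <= (n * denn PQ)%N%:R then ratr PQ * x
  else ratr ab * (x - (n * denn PQ)%N%:R) + (numq PQ)%:~R *+ n.

(* W_{p/q}: for 0 < p/q <= 1, the digits of the line y = (p/q) x have period q. *)
Definition Mword (r : rat) : seq bool := mkseq (Mdigits (line r)) (denn r).

Definition BL_digits (PQ ab : rat) (n : nat) : nat -> bool :=
  Mdigits (broken_line PQ ab n).

Definition BL_theta (PQ ab : rat) (n : nat) : R :=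
  binary_number (BL_digits PQ ab n).

Definition Mdecomposition (PQ ab ST : rat) (n : nat) (zeta : seq rat) : Prop :=
  [/\ (0 < size zeta)%N,
      {subset zeta <= [:: ST; PQ]}
    & flatten [seq Mword z | z <- zeta] = mkseq (BL_digits PQ ab n) (denn ab)].

(* The digit of index i is the first digit of one of the words of the
   decomposition, say of the word of index j, and from there on (cyclically)
   the decomposition reads s times W_{P/Q} and then W_{S/T}. *)
Definition starts_string (PQ ST : rat) (zeta : seq rat) (s i : nat) : Prop :=
  exists2 j : nat,
    (j < size zeta)%N /\
      i = size (flatten [seq Mword z | z <- take j zeta])
  & (forall t : nat, (t < s)%N ->
       nth 0 zeta ((j + t) %% size zeta)%N = PQ) /\
    nth 0 zeta ((j + s) %% size zeta)%N = ST.

End Mseq.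

Inductive ksymbol := K0 | K1 | Kstar.

(* For theta in ]0, 1[ the points theta/2 < (theta+1)/2 lie in ]0, 1[, and
   points of the circle are represented by their fractional parts in [0, 1[:
   the arc ]theta/2, (theta+1)/2[ is then an interval, and the complementary
   open arc is the part of [0, 1[ outside its closure. *)
Definition kneading (R : realType) (theta : R) (i : nat) : ksymbol :=
  let x := 2 ^+ i * theta in
  let t := x - (Num.floor x)%:~R in
  if (t == theta / 2) || (t == (theta + 1) / 2) then Kstar
  else if theta / 2 < t < (theta + 1) / 2 then K1
  else K0.

(* Main.v *)
Require Import Defs.
From mathcomp Require Import all_boot all_order all_algebra.
From mathcomp Require Import all_classical all_reals all_analysis.
From mathcomp Require Import zify ring lra.
Set Implicit Arguments.
Unset Strict Implicit.
Unset Printing Implicit Defensive.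

Import Order.TTheory GRing.Theory Num.Theory.
Import numFieldNormedType.Exports.
Local Open Scope ring_scope.

(** Put D = aQ - bP and E = bS - aT.  Then a = EP + DS and b = EQ + DT, and the condition
    a/b < S_n/T_n says that (n-1)D < E.  Put k = nD; then 0 < k < D + E <= a < b.

    A digit of an M-sequence tells whether the graph reaches an integer height over one
    unit interval.  To the right of the vertical axis no lattice point separates the broken
    line from the straight line of slope a/b through its corner (nQ, nP), so its digits
    are those of that line.  They code a rotation of Z/b: with r_x = k + (b-a)x mod b, the
    digit of index i is 1 exactly when r_(i+1) < a ([BL_digits_rot]).  This also makes the
    sequence periodic of period b.

    The rotation by -a keeps the order inside each of the two coding intervals, so the
    number whose binary digits are read along the orbit from a residue r is a strictly
    decreasing function of r ([orbit_value_decr]).  The points 2^i theta mod 1 are these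
    numbers; (theta+1)/2 is the one of the residue r_0 = k, and theta/2 lies below all of
    them.  Hence the kneading sequence reads 0, * or 1 according as the residue is smaller
    than, equal to or larger than k ([kneading_orbit]).

    (a) The first return of the rotation to [0, D+E) exchanges two intervals.  A residue
    below D returns after T steps, increased by E, and W_{S/T} is read on the way; any other
    returns after Q steps, decreased by D, and W_{P/Q} is read ([rot_digits_ST],
    [rot_digits_PQ], [rot_block_start]).  As k < D+E, this gives the decomposition of the
    period.  At a residue rho, exactly s words W_{P/Q} precede the next W_{S/T} if and only if
    sD <= rho < (s+1)D ([block_run]); this holds for some s < n exactly when rho < nD = k.
    No other decomposition exists, because W_{P/Q} ends with 0 W_{S/T} while both words end
    with 1, so that words can be split off from the right ([decomposition_unique]).

    (b) The positions of the stars give b.  The times at which the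
    residue is at most k form an arithmetic progression modulo b, and translation by its
    step leads out of it from one end only; this determines the step, hence a
    ([rot_coding_slope]), and then k ([rot_coding_threshold]).
    It remains to recover D from a, b and k = nD.  If D' < D for a second solution, then its
    Farey interval lies deeper in the Stern-Brocot tree, and comparing denominators
    ([farey_gap]) gives D' + E' <= D, so that n'D' < D' + E' <= D <= nD ([threshold_lt]).
    Finally, D determines P/Q as the solution of aQ - bP = D with Q < b, and P/Q determines
    S/T as its neighbor with T < Q ([farey_weights_unique]). *)

(** * Digits of an M-sequence as integer heights reached in unit intervals *)

(** Here [p N] is the place of the N-th block, which is 01 if [d N] and 0 otherwise: collapsing
    turns each block into the single digit [d N].  The blocks have length at most 2, so
    [2 * i.+1] symbols are enough to see the first [i.+1] of them. *)
Lemma collapse01_blocks (u d : nat -> bool) (p : nat -> nat) :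
  p 0%N = 0%N -> (forall N, p N.+1 = (p N).+1 + d N)%N ->
  (forall N, u (p N) = false) -> (forall N, d N -> u (p N).+1 = true) ->
  collapse01 u =1 d.
Proof.
move=> p0 pS u0 u1 i.
have keepE N : [seq u j | j <- iota 0 (p N) & ~~ (~~ u j && u j.+1)] = mkseq d N.
  elim: N => [|N IHN]; first by rewrite p0.
  rewrite pS addSnnS iotaD filter_cat map_cat IHN add0n mkseqS -cats1.
  congr (_ ++ _).
  have := u1 N; have := u0 N.+1; rewrite pS addSn.
  case: (d N) => /= [u0' /(_ isT) u1'|u0' _].
    by rewrite u0 u1' /= u1'.
  by rewrite ?addn0 in u0'; rewrite u0 u0' /= u0.
have pi : (p i.+1 <= 2 * i.+1)%N.
  elim: i.+1 => [|N IHN]; first by rewrite p0.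
  by rewrite pS; case: (d N); lia.
rewrite /collapse01 -(subnKC pi) iotaD filter_cat map_cat nth_cat keepE size_mkseq.
by rewrite ltnSn nth_mkseq.
Qed.

Lemma between_int (R : realType) (m : int) (v : R) :
  m%:~R < v < (m + 1)%:~R -> v \isn't a Num.int.
Proof.
move=> /andP[mv vm]; apply/negP => /intrP[k vE]; move: mv vm; rewrite vE !ltr_int.
by lia.
Qed.

(** The graphs in question are affine over every unit interval, with slopes in ]0, 1]; this is
    all that the digits depend on. *)
Section Crossings.
Variables (R : realType) (f : R -> R) (s : nat -> R).
Hypothesis f0 : f 0 = 0.
Hypothesis s_bounds : forall j, 0 < s j <= 1.
Hypothesis f_affine : forall (j : nat) x, j%:R <= x <= j.+1%:R ->
  f x = f j%:R + s j * (x - j%:R).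

Definition level_in_cell (j : nat) : bool :=
  (Num.ceil (f j%:R))%:~R < f j.+1%:R.

(** The symbols contributed by the intervals [1, 2[, [2, 3[, ...: each has one vertical
    crossing, at its left end, followed by at most one horizontal crossing. *)
Definition cell_words (N : nat) : seq bool :=
  flatten (mkseq (fun j => false :: nseq (level_in_cell j.+1) true) N).

Lemma next_crossingE x y : x < y -> 0 < y -> y \is a Num.int \/ f y \is a Num.int ->
  (forall z, x < z < y -> z \isn't a Num.int /\ f z \isn't a Num.int) ->
  next_crossing f x = y.
Proof.
move=> xy y_gt0 fy noz; rewrite /next_crossing.
have lby : lbound (crossings f `&` [set y | x < y])%classic y.
  move=> z [[_ fz] xz]; rewrite leNgt; apply/negP => zy.
  have /noz[/negP zN /negP fzN] : x < z < y by rewrite xz.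
  by case: fz.
apply/le_anti/andP; split.
  apply: ge_inf; first by exists y.
  by split.
by apply: lb_le_inf => //; exists y; split.
Qed.

(** A slope at most 1 is what prevents two horizontal crossings over one unit interval. *)
Lemma cell_lt (j : nat) x y : j%:R <= x -> x < y -> y <= j.+1%:R ->
  f x < f y <= f x + (y - x).
Proof.
move=> jx xy yj; have /andP[s_gt0 s_le1] := s_bounds j.
rewrite (@f_affine j x) ?(@f_affine j y); last 2 first.
- by rewrite yj (le_trans jx (ltW xy)).
- by rewrite jx (le_trans (ltW xy) yj).
by apply/andP; split; nra.
Qed.

Lemma cell_not_int (j : nat) (x : R) : j%:R < x < j.+1%:R -> x \isn't a Num.int.
Proof.
move=> h; apply: (@between_int _ j).
by rewrite -[(_ + 1)%R]/(Posz j + 1%N)%R -PoszD addn1.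
Qed.

(** The crossings in [j+1, j+2[ are one or two, according to whether an integer height
    strictly between the heights of the two ends is reached; if the left end itself has
    integer height, a single crossing yields both symbols. *)
Lemma next_crossing_cell (j : nat) : exists K,
  iter K.+1 (next_crossing f) j.+1%:R = j.+2%:R /\
  (flatten [seq crossing_word f (iter i (next_crossing f) j.+1%:R) | i <- iota 0 K.+1]
    = false :: nseq (level_in_cell j.+1) true /\
  forall i, (i <= K)%N -> crossing_word f (iter i (next_crossing f) j.+1%:R) != [::]).
Proof.
have next_int (x : R) : j.+1%:R <= x < j.+2%:R ->
    (forall z, x < z < j.+2%:R -> f z \isn't a Num.int) ->
    next_crossing f x = j.+2%:R.
  move=> /andP[jx xj] h; apply: next_crossingE => //.
  - by left; rewrite natr_int.
  - move=> z /andP[xz zj]; split; last by apply: h; rewrite xz.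
    by apply: (@cell_not_int j.+1); rewrite zj (le_lt_trans jx).
have jj : (j.+1%:R : R) < j.+2%:R by rewrite ltr_nat.
have /andP[ff ffD] := cell_lt (lexx _) jj (lexx _).
have jjE : (j.+2%:R - j.+1%:R : R) = 1 by rewrite -natrB // subSnn.
rewrite jjE in ffD.
have fceil := ceil_itv (f j.+1%:R).
set m := Num.ceil (f j.+1%:R) in fceil *.
case/andP: fceil; rewrite intrD => mf fm.
have jint : (j.+1%:R : R) \is a Num.int by rewrite natr_int.
have [lvl|lvl] := boolP (level_in_cell j.+1); last first.
  have fm' : f j.+2%:R <= m%:~R by rewrite leNgt.
  have fN : f j.+1%:R \isn't a Num.int.
    by apply: (@between_int _ (m - 1)); rewrite subrK intrD mf (lt_le_trans ff).
  exists 0%N; split; last split.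
  - apply: next_int => [|z /andP[jz zj]]; first by rewrite lexx.
    have /andP[fz _] := cell_lt (lexx _) jz (ltW zj).
    have /andP[fz' _] := cell_lt (ltW jz) zj (lexx _).
    apply: (@between_int _ (m - 1)).
    by rewrite subrK intrD (lt_trans mf fz) (lt_le_trans fz').
  - by rewrite /= cats0 /crossing_word jint (negbTE fN).
  - by move=> [|i] //= _; rewrite /crossing_word jint.
rewrite /level_in_cell -/m in lvl.
have [fE|fN] := eqVneq (f j.+1%:R) m%:~R.
  exists 0%N; split; last split.
  - apply: next_int => [|z /andP[jz zj]]; first by rewrite lexx.
    have /andP[fz _] := cell_lt (lexx _) jz (ltW zj).
    have /andP[fz' _] := cell_lt (ltW jz) zj (lexx _).
    apply: (@between_int _ m); rewrite intrD; apply/andP; split; lra.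
  - by rewrite /= cats0 /crossing_word jint fE intr_int.
  - by move=> [|i] //= _; rewrite /crossing_word jint.
have fm' : f j.+1%:R < m%:~R by rewrite lt_neqAle fN.
have fnint : f j.+1%:R \isn't a Num.int.
  by apply: (@between_int _ (m - 1)); rewrite subrK intrD mf fm'.
have /andP[s_gt0 s_le1] := s_bounds j.+1.
(* the abscissa at which the segment of slope s reaches the height m *)
pose y := j.+1%:R + (m%:~R - f j.+1%:R) / s j.+1.
have jy : j.+1%:R < y by rewrite ltrDl divr_gt0 // subr_gt0.
have fj2 : f j.+2%:R = f j.+1%:R + s j.+1.
  by rewrite (@f_affine j.+1) ?jjE ?mulr1 // lexx ltW.
have yj : y < j.+2%:R.
  rewrite /y -ltrBrDl jjE ltr_pdivrMr // mul1r; lra.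
have fy : f y = m%:~R.
  rewrite (@f_affine j.+1) ?(ltW jy) ?(ltW yj) // /y.
  by field; rewrite gt_eqF.
have next1 : next_crossing f j.+1%:R = y.
  apply: next_crossingE => //.
  - by apply: lt_trans jy.
  - by right; rewrite fy intr_int.
  - move=> z /andP[jz zy]; split.
      by apply: (@cell_not_int j.+1); rewrite jz (lt_trans zy).
    have /andP[fz _] := cell_lt (lexx _) jz (ltW (lt_trans zy yj)).
    have /andP[fz' _] := cell_lt (ltW jz) zy (ltW yj).
    by apply: (@between_int _ (m - 1)); rewrite subrK intrD (lt_trans mf) //= -fy.
have yN : y \isn't a Num.int by apply: (@cell_not_int j.+1); rewrite jy.
exists 1%N; split; last split.
- rewrite /= next1; apply: next_int => [|z /andP[yz zj]]; first by rewrite ltW.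
  have /andP[fz _] := cell_lt (ltW jy) yz (ltW zj).
  have /andP[fz' _] := cell_lt (ltW (lt_trans jy yz)) zj (lexx _).
  apply: (@between_int _ m); rewrite intrD; apply/andP; split; lra.
- by rewrite /= next1 /crossing_word jint (negbTE fnint) (negbTE yN) fy intr_int.
- by move=> [|[|i]] //= _; rewrite /crossing_word ?next1 ?jint // (negbTE yN) fy intr_int.
Qed.

(** Over ]0, 1[ the graph stays strictly between the heights 0 and 1, so nothing precedes the
    crossing at 1; the interval [0, 1[ therefore contributes no symbol. *)
Lemma first_crossing : next_crossing f 0 = 1.
Proof.
apply: next_crossingE => //; first by left; rewrite rpred1.
move=> z /andP[z0 z1]; split; first by apply: (@cell_not_int 0); rewrite z0.
have /andP[fz fz'] := @cell_lt 0 0 z (lexx _) z0 (ltW z1).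
rewrite f0 in fz fz'; apply: (@between_int _ 0).
by rewrite fz add0r (le_lt_trans fz') // add0r subr0.
Qed.

(** Going through the unit intervals one by one, K counts the crossings met so far.  The words
    are nonempty, which bounds the number of symbols from below by that of crossings. *)
Lemma crossing_words_prefix N : exists K, [/\ (N <= K)%N,
  nth_crossing f K = N.+1%:R,
  flatten [seq crossing_word f (nth_crossing f i) | i <- iota 0 K] = cell_words N &
  forall i, (i < K)%N -> crossing_word f (nth_crossing f i) != [::]].
Proof.
elim: N => [|N [K [NK KN KE K0]]].
  by exists 0%N; split => //; rewrite -[in RHS]first_crossing.
have [L [LN [LE L0]]] := next_crossing_cell N.
have shift i : nth_crossing f (K + i)%N = iter i (next_crossing f) N.+1%:R.
  by rewrite -KN /nth_crossing -iterD addnS addnC.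
exists (K + L.+1)%N; split.
- by lia.
- by rewrite shift.
- rewrite iotaD map_cat flatten_cat KE /cell_words mkseqS -cats1 flatten_cat; congr (_ ++ _).
  rewrite [RHS]/= cats0 -LE add0n -[X in iota X]addn0 iotaDl -map_comp; congr flatten.
  by apply: eq_map => i /=; rewrite shift.
- move=> i iK; have [/K0 //|Ki] := ltnP i K.
  by rewrite -(subnKC Ki) shift; apply: L0; lia.
Qed.

Lemma size_flatten_nonempty (T : eqType) (ss : seq (seq T)) :
  (forall t, t \in ss -> t != [::]) -> (size ss <= size (flatten ss))%N.
Proof.
move=> ss_neq0; rewrite size_flatten sumnE -sum1_size big_map big_seq [leqRHS]big_seq.
by apply: leq_sum => t /ss_neq0; rewrite lt0n size_eq0.
Qed.

Lemma kappaE N i : (i < N)%N -> kappa f i = nth false (cell_words N) i.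
Proof.
move=> iN; have [K [NK _ <- K0]] := crossing_words_prefix N.
have iK : (i.+1 <= K)%N by apply: leq_trans NK.
rewrite /kappa -(subnKC iK) iotaD map_cat flatten_cat nth_cat ifT //.
have := @size_flatten_nonempty _ [seq crossing_word f (nth_crossing f j) | j <- iota 0 i.+1].
rewrite size_map size_iota; apply => w /mapP[j]; rewrite mem_iota => ji ->.
by apply: K0; lia.
Qed.

Lemma cell_wordsS N : cell_words N.+1 = cell_words N ++ false :: nseq (level_in_cell N.+1) true.
Proof. by rewrite /cell_words mkseqS -cats1 flatten_cat /= cats0. Qed.

Lemma kappa_nth N i : (i < size (cell_words N))%N -> kappa f i = nth false (cell_words N) i.
Proof.
move=> iN; rewrite (@kappaE (N + i.+1)); last by lia.
elim: i.+1 => [|M IHM]; first by rewrite addn0.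
rewrite addnS cell_wordsS nth_cat ifT //.
apply: leq_trans iN _; elim: M {IHM} => [|M IHM]; first by rewrite addn0.
by rewrite addnS cell_wordsS size_cat (leq_trans IHM) // leq_addr.
Qed.

Lemma MdigitsE : Mdigits f =1 (fun i => level_in_cell i.+1).
Proof.
apply: (@collapse01_blocks _ _ (fun N => size (cell_words N))) => //.
- by move=> N; rewrite cell_wordsS size_cat /= size_nseq addnS.
- move=> N; rewrite (@kappa_nth N.+1) cell_wordsS ?nth_cat ?ltnn ?subnn //.
  by rewrite size_cat /=; lia.
- move=> N dN; rewrite (@kappa_nth N.+1) cell_wordsS ?nth_cat dN.
    by rewrite ltnNge leqnSn subSnn.
  by rewrite size_cat /=; lia.
Qed.

End Crossings.

(** * Numbers with given binary digits *)

Section BinaryNumbers.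
Variable R : realType.
Implicit Types u : nat -> bool.

Let partial u n : R := series (fun i : nat => (u i)%:R / 2 ^+ i.+1 : R) n.

Lemma partial_sum_bounds u n : 0 <= partial u n <= 1 - 2 ^- n.
Proof.
rewrite /partial; elim: n => [|n /andP[ge0 le1]].
  by rewrite /series /= big_geq // expr0 invr1 subrr lexx.
rewrite seriesSr; have h : (0 : R) < 2 ^- n by rewrite invr_gt0 exprn_gt0.
rewrite exprS invfM; case: (u n); rewrite /= ?mul1r ?mul0r; apply/andP; split; lra.
Qed.

Lemma partial_sum_cvg u : cvgn (partial u).
Proof.
apply: nondecreasing_is_cvgn.
  apply/nondecreasing_seqP => n; rewrite /partial seriesSr lerDl.
  by rewrite divr_ge0 ?exprn_ge0.
exists 1 => _ [n _ <-]; have /andP[_ le1] := partial_sum_bounds u n.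
by apply: le_trans le1 _; rewrite gerBl invr_ge0 exprn_ge0.
Qed.

Lemma binary_number_bounds u : 0 <= binary_number R u <= 1.
Proof.
apply/andP; split.
  apply: limr_ge; first exact: partial_sum_cvg.
  by near=> n; have /andP[] := partial_sum_bounds u n.
apply: limr_le; first exact: partial_sum_cvg.
near=> n; have /andP[_ le1] := partial_sum_bounds u n.
by apply: le_trans le1 _; rewrite gerBl invr_ge0 exprn_ge0.
Unshelve. all: by end_near.
Qed.

Lemma binary_number_step u :
  binary_number R u = ((u 0%N)%:R + binary_number R (fun i => u i.+1)) / 2.
Proof.
pose v i := u i.+1.
have sumS n : partial u n.+1 = ((u 0%N)%:R + partial v n) / 2.
  rewrite /partial; elim: n => [|n IHn].
    by rewrite seriesSr /series /= !big_geq // expr1 add0r addr0.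
  rewrite seriesSr IHn [in RHS]seriesSr addrA [RHS]mulrDl; congr (_ + _).
  by rewrite -mulrA -invfM -exprSr.
apply: cvg_lim => //; rewrite -cvg_shiftS /=.
rewrite -/(partial u) (funext sumS).
by apply: cvgMl; apply: cvgD; [apply: cvg_cst|exact: partial_sum_cvg].
Qed.

End BinaryNumbers.

(** * Rotations of Z/b and their codings *)

Section Rotation.
Local Open Scope nat_scope.

(** The orbit of k under the rotation by -a of the integers mod b, written with b - a to stay
    in the natural numbers. *)
Definition rot_orbit (a b k x : nat) : nat := (k + (b - a) * x) %% b.

(** The shift by one is the one of M-sequences, whose first digit belongs to the interval
    [1, 2[ and not to [0, 1[. *)
Definition rot_digits (a b k i : nat) : bool := rot_orbit a b k i.+1 < a.

Lemma coprime_inv c m : 0 < m -> coprime c m -> exists u, c * u = 1 %[mod m].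
Proof.
move=> m_gt0; case: c => [|c] cm.
  by exists 0; move: cm; rewrite /coprime gcd0n => /eqP ->; rewrite !modn1.
have [u uE] := coprimeP m (ltn0Sn c) cm.
exists u.1; have -> : c.+1 * u.1 = 1 + u.2 * m by lia.
by rewrite addnC modnMDl.
Qed.

Lemma coprime_subl a b : a <= b -> coprime a b -> coprime (b - a) b.
Proof.
move=> ab; rewrite /coprime -[X in _ -> gcdn _ X == _](subnK ab) gcdnDl [gcdn (b - a) a]gcdnC.
by rewrite -(gcdnDl a (b - a)) subnKC.
Qed.

Variables a b k : nat.
Hypothesis a_lt_b : a < b.
Local Notation r := (rot_orbit a b k).

Lemma rot_lt x : r x < b.
Proof. by rewrite ltn_mod (leq_trans _ a_lt_b). Qed.

Lemma rotD x y : r (x + y) = (r x + (b - a) * y) %% b.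
Proof. by rewrite /rot_orbit mulnDr addnA modnDml. Qed.

Lemma rotS x : r x.+1 = if r x < a then r x + (b - a) else r x - a.
Proof.
have rb := rot_lt x; rewrite -addn1 rotD muln1; case: ltnP => ra.
  by rewrite modn_small; lia.
have -> : r x + (b - a) = (r x - a) + b by lia.
by rewrite modnDr modn_small; lia.
Qed.

Hypothesis ab_coprime : coprime a b.

Lemma rot_shift x : exists h, forall y, r (y + h) = (r y + x) %% b.
Proof.
have b_gt0 : 0 < b by lia.
have [u uE] := coprime_inv b_gt0 (coprime_subl (ltnW a_lt_b) ab_coprime).
exists (u * x) => y; rewrite rotD mulnA -modnDmr -modnMml uE.
by rewrite modnMml mul1n modnDmr.
Qed.

Lemma rot_hit x c : c < b -> exists y, r (x + y) = c.
Proof.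
move=> cb; have rb := rot_lt x; have [h hE] := rot_shift (c + (b - r x)).
exists h; rewrite hE (_ : _ + _ = c + b) ?modnDr ?modn_small //.
by lia.
Qed.

Lemma rot_orbit_eq x y : (r x == r y) = (x == y %[mod b]).
Proof.
rewrite /rot_orbit eqn_modDl; have cop := coprime_subl (ltnW a_lt_b) ab_coprime.
wlog xy : x y / x <= y.
  by move=> h; case: (leqP x y) => [/h //|/ltnW /h]; rewrite eq_sym [in RHS]eq_sym.
rewrite eq_sym [in RHS]eq_sym !eqn_mod_dvd ?leq_mul2l ?xy ?orbT // -mulnBr.
by rewrite Gauss_dvdr // coprime_sym.
Qed.

Hypothesis k_lt_b : k < b.

Lemma rot0 : r 0 = k.
Proof. by rewrite /rot_orbit muln0 addn0 modn_small. Qed.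

Lemma rot_eq_start x : (r x == k) = (b %| x).
Proof. by rewrite -{2}rot0 rot_orbit_eq mod0n. Qed.

End Rotation.

(** * Kneading sequence of a rotation coding *)

Section OrbitValues.
Variables (R : realType) (a b k : nat).
Hypotheses (a_lt_b : (a < b)%N) (k_lt_a : (k < a)%N) (ab_coprime : coprime a b).
Local Notation r := (rot_orbit a b k).
Let k_lt_b : (k < b)%N := ltn_trans k_lt_a a_lt_b.

Definition orbit_value (x : nat) : R := binary_number R (fun j => r (x + j) < a)%N.
Local Notation val := orbit_value.

Lemma orbit_value_step x : val x = ((r x < a)%N%:R + val x.+1) / 2.
Proof.
rewrite /orbit_value binary_number_step addn0; do 3 f_equal.
by apply/funext => j; rewrite addnS.
Qed.

Lemma orbit_value_congr x y : r x = r y -> val x = val y.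
Proof.
by move=> rxy; rewrite /orbit_value; congr binary_number; apply/funext => j; rewrite !rotD rxy.
Qed.

(** The residue k < a is visited, so some digit is 1. *)
Lemma orbit_value_gt0 x : 0 < val x.
Proof.
have [y] := rot_hit k a_lt_b ab_coprime x k_lt_b.
elim: y x => [|y IHy] x.
  rewrite addn0 orbit_value_step => ->; rewrite k_lt_a.
  have /andP[] := binary_number_bounds R (fun j => r (x.+1 + j) < a)%N.
  by rewrite -/(val x.+1) /=; lra.
rewrite -addSnnS => /IHy; rewrite [val x]orbit_value_step.
by case: (_ < a)%N => /=; lra.
Qed.

(** The residue a is visited, so some digit is 0. *)
Lemma orbit_value_lt1 x : val x < 1.
Proof.
have [y] := rot_hit k a_lt_b ab_coprime x a_lt_b.
elim: y x => [|y IHy] x.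
  rewrite addn0 orbit_value_step => ->; rewrite ltnn.
  have /andP[] := binary_number_bounds R (fun j => r (x.+1 + j) < a)%N.
  by rewrite -/(val x.+1) /=; lra.
rewrite -addSnnS => /IHy; rewrite [val x]orbit_value_step.
by case: (_ < a)%N => /=; lra.
Qed.

(** As long as the digits agree, the two orbits move by the same amount and keep their order.
    They separate at the latest when the smaller residue reaches a - 1, the last one with
    digit 1; at the first separation the smaller residue has the digit 1. *)
Lemma orbit_value_decr x y : (r x < r y)%N -> val y < val x.
Proof.
have a1b : (a.-1 < b)%N by lia.
have [z] := rot_hit k a_lt_b ab_coprime x a1b.
elim: z x y => [|z IHz] x y; rewrite [val x]orbit_value_step [val y]orbit_value_step.
  rewrite addn0 => rxE ry; have := orbit_value_lt1 y.+1; have := orbit_value_gt0 x.+1.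
  have -> : (r x < a)%N = true by rewrite rxE; lia.
  have -> : (r y < a)%N = false by apply/negbTE; rewrite -leqNgt; lia.
  by rewrite /=; lra.
rewrite -addSnnS => rz rxy.
have := orbit_value_lt1 y.+1; have := orbit_value_gt0 x.+1; have := IHz x.+1 y.+1 rz.
rewrite !(rotS k a_lt_b).
case: (ltnP (r x) a) => ra; case: (ltnP (r y) a) => rb /=; last 1 first.
- by move=> /(_ ltac:(lia)); lra.
- by move=> /(_ ltac:(lia)); lra.
- by lra.
- by lia.
Qed.

Local Notation theta := (val 1).

Lemma orbit_value_fractional_part i :
  let x := 2 ^+ i * theta in x - (Num.floor x)%:~R = val i.+1.
Proof.
have [m mE] : exists m : int, 2 ^+ i * theta = m%:~R + val i.+1.
  elim: i => [|i [m mE]]; first by exists 0; rewrite expr0 mul1r add0r.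
  exists (m * 2 + (r i.+1 < a)%N%:Z).
  rewrite exprS -mulrA mE [val i.+1]orbit_value_step intrD intrM.
  by rewrite natz; field.
have floorE : Num.floor (2 ^+ i * theta) = m.
  apply: floor_def; rewrite mE intrD lerDl ltrD2l.
  by rewrite (ltW (orbit_value_gt0 _)) (orbit_value_lt1 _).
by move=> x; rewrite /x floorE mE addrAC subrr add0r.
Qed.

(** The point (theta+1)/2 is the value of the residue k, which has the digit 1 and precedes the
    residue giving theta.  The point theta/2 is smaller than every value, so comparison with
    (theta+1)/2 decides. *)
Lemma kneading_orbit i : kneading theta i =
  if (r i.+1 < k)%N then K0 else if r i.+1 == k then Kstar else K1.
Proof.
rewrite /kneading orbit_value_fractional_part.
have vb : val 0 = (theta + 1) / 2.
  by rewrite orbit_value_step rot0 // k_lt_a addrC.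
have th1 := orbit_value_lt1 1; have th0 := orbit_value_gt0 1.
case: ltngtP => [rk|rk|rk].
- have : val 0 < val i.+1 by apply: orbit_value_decr; rewrite rot0.
  rewrite vb => lt_v; rewrite [X in _ || X]gt_eqF // gt_eqF; last by lra.
  by rewrite [X in _ && X]ltNge ltW // andbF.
- have : val i.+1 < val 0 by apply: orbit_value_decr; rewrite rot0.
  rewrite vb => lt_v; rewrite [X in _ || X]lt_eqF // lt_v andbT.
  have gt_v : theta / 2 < val i.+1.
    (* Residues with digit 0 have successors smaller than b - a, whereas theta is the value
       of k + b - a. *)
    rewrite [val i.+1]orbit_value_step; have := orbit_value_gt0 i.+2.
    case: ltnP => ra /=; first lra.
    have : theta < val i.+2; last by lra.
    apply: orbit_value_decr; rewrite (rotS _ _ 0) // (rotS _ _ i.+1) // rot0 // k_lt_a.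
    by rewrite [(_ i.+1 < a)%N]ltnNge ra /=; have := rot_lt k a_lt_b i.+1; lia.
  by rewrite gt_v gt_eqF.
- by rewrite -vb (@orbit_value_congr _ 0) ?eqxx ?orbT // rot0 // rk.
Qed.

End OrbitValues.

(** * Lattice points below lines with neighboring slopes *)

Section Levels.

(** The residue is the gap between (ax - rho)/b and the next integer, in units of 1/b; that
    integer is reached before x + 1 when the gap is smaller than the slope a/b. *)
Lemma rot_levelP (a b rho x : nat) : (0 < a <= b)%N ->
  reflect (exists m : int,
      a%:Z * x%:Z - rho%:Z <= b%:Z * m /\ b%:Z * m < a%:Z * x.+1%:Z - rho%:Z)
    (rot_orbit a b rho x < a)%N.
Proof.
move=> /andP[a_gt0 ab]; rewrite /rot_orbit.
set y := (rho + _)%N; have yE := divn_eq y b.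
have ry : (y %% b < b)%N by rewrite ltn_mod; lia.
set q := (y %/ b)%N in yE; set r := (y %% b)%N in yE ry *.
have {}yE : a%:Z * x%:Z - rho%:Z = b%:Z * (x%:Z - q%:Z) - r%:Z.
  have : (y + a * x = rho + b * x)%N.
    by rewrite /y mulnBl; have := leq_mul2r x a b; rewrite ab orbT; lia.
  by rewrite yE; lia.
have -> : a%:Z * x.+1%:Z - rho%:Z = b%:Z * (x%:Z - q%:Z) - r%:Z + a%:Z by lia.
rewrite yE; apply: (iffP idP) => [ra|[m [le_m lt_m]]].
  by exists (x%:Z - q%:Z); split; lia.
suff mE : m = x%:Z - q%:Z by move: lt_m; rewrite mE; lia.
have b_gt0 : (0 < b%:Z)%R by lia.
by apply/eqP; rewrite eq_le; apply/andP; split; rewrite leNgt; apply/negP => h; nia.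
Qed.

Variables (P Q S T D E : nat).

(** P/Q < S/T are Farey neighbors and P/Q is the mediant of S/T and of the fraction
    (P-S)/(Q-T).  The weight D is the coefficient of (T, S) when (b, a) is written as
    E(Q, P) + D(T, S). *)
Record farey_weights : Prop := FareyWeights {
  fw_det : (S * Q = P * T + 1)%N;
  fw_T : (0 < T < Q)%N;
  fw_SP : (S <= P)%N;
  fw_ST : (S <= T)%N;
  fw_D : (0 < D)%N }.
Hypothesis W : farey_weights.

Local Notation a := (E * P + D * S)%N.
Local Notation b := (E * Q + D * T)%N.

(** The lines of slopes P/Q through 0 and a/b through (0, -rho/b) have the same lattice points
    on or above them in the given range.  In the coordinates j = Qm - Px and l = Tm - Sx, in which
    bm - ax = Ej + Dl and x = Tj - Ql, the claim is that j >= 0 is equivalent to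
    Ej + Dl + rho >= 0: the range of x gives l >= -c when j >= 0, and l <= -1 when j <= -1.
    The case c = 1 yields the word W_{P/Q}, the case c = n the broken line. *)
Lemma level_PQ (c x rho : nat) (m : int) :
  (0 < x < c.+1 * Q)%N -> (c * D <= rho < D + E)%N ->
  (P%:Z * x%:Z <= Q%:Z * m) = (a%:Z * x%:Z - rho%:Z <= b%:Z * m).
Proof.
case: W => det /andP[T_gt0 TQ] SP ST D_gt0 /andP[x_gt0 xQ] /andP[cD rhoDE].
pose j := Q%:Z * m - P%:Z * x%:Z; pose l := T%:Z * m - S%:Z * x%:Z.
have xE : x%:Z = T%:Z * j - Q%:Z * l by rewrite /j /l; nia.
have abE : b%:Z * m - a%:Z * x%:Z = E%:Z * j + D%:Z * l by rewrite /j /l; lia.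
apply/idP/idP => h.
  have j0 : 0 <= j by rewrite /j; lia.
  have lc : - c%:Z <= l by rewrite leNgt; apply/negP => lc; nia.
  suff : 0 <= E%:Z * j + D%:Z * l + rho%:Z by lia.
  by nia.
rewrite leNgt; apply/negP => h'.
have j0 : j <= -1 by rewrite /j; lia.
have l0 : l <= -1 by rewrite leNgt; apply/negP => l0; nia.
have : 0 <= E%:Z * j + D%:Z * l + rho%:Z by lia.
by nia.
Qed.

(** The analogue of [level_PQ] for the slope S/T, with l in the place of j. *)
Lemma level_ST (x rho : nat) (m : int) :
  (0 < x <= T.+1)%N -> (rho < D)%N ->
  (S%:Z * x%:Z <= T%:Z * m) = (a%:Z * x%:Z - rho%:Z <= b%:Z * m).
Proof.
case: W => det /andP[T_gt0 TQ] SP ST D_gt0 /andP[x_gt0 xT] rhoD.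
pose j := Q%:Z * m - P%:Z * x%:Z; pose l := T%:Z * m - S%:Z * x%:Z.
have xE : x%:Z = T%:Z * j - Q%:Z * l by rewrite /j /l; nia.
have abE : b%:Z * m - a%:Z * x%:Z = E%:Z * j + D%:Z * l by rewrite /j /l; lia.
apply/idP/idP => h.
  have l0 : 0 <= l by rewrite /l; lia.
  have j0 : 0 <= j by rewrite leNgt; apply/negP => j0; nia.
  suff : 0 <= E%:Z * j + D%:Z * l + rho%:Z by lia.
  by nia.
rewrite leNgt; apply/negP => h'.
have l0 : l <= -1 by rewrite /l; lia.
have j0 : j <= 0 by rewrite leNgt; apply/negP => j0; nia.
have : 0 <= E%:Z * j + D%:Z * l + rho%:Z by lia.
by nia.
Qed.

End Levels.

(** * Digits of lines and broken lines as rotation codings *)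

Section RealDigits.
Variable R : realType.

Lemma level_in_cell_rot (f : R -> R) (a b rho j : nat) : (0 < a <= b)%N ->
  (forall x (m : int), (j <= x <= j.+1)%N ->
    (f x%:R <= m%:~R) = (a%:Z * x%:Z - rho%:Z <= b%:Z * m)) ->
  level_in_cell f j = (rot_orbit a b rho j < a)%N.
Proof.
move=> ab fE; apply/idP/(rot_levelP rho j ab) => [lvl|[m [le_m lt_m]]].
  exists (Num.ceil (f j%:R)); split; first by rewrite -fE ?leqnn ?leqnSn //; exact: ceil_ge.
  by rewrite ltNge -fE ?leqnn ?leqnSn // -ltNge.
rewrite -fE ?leqnn ?leqnSn // -ceil_le_int in le_m.
rewrite ltNge -fE ?leqnn ?leqnSn // -ltNge in lt_m.
by apply: le_lt_trans lt_m; rewrite ler_int.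
Qed.

Lemma ratrE_nat (r : rat) (p q : nat) : numq r = p -> denq r = q ->
  ratr r = p%:R / q%:R :> R.
Proof. by move=> rp rq; rewrite /ratr rp rq. Qed.

Lemma line_digits (r : rat) (p q : nat) : (0 < p <= q)%N -> numq r = p -> denq r = q ->
  Mdigits (@line R r) =1 rot_digits p q 0.
Proof.
move=> pq rp rq i; have rE := ratrE_nat rp rq; have [p_gt0 le_pq] := andP pq.
have q_gt0 : (0 : R) < q%:R by rewrite ltr0n; lia.
rewrite (@MdigitsE _ (@line R r) (fun=> ratr r)).
- apply: level_in_cell_rot => // x m _.
  rewrite /line rE mulrAC ler_pdivrMr // subr0 [m%:~R * _]mulrC.
  by rewrite !pmulrn -!intrM ler_int.
- by rewrite /line mulr0.
- by move=> j; rewrite rE ler_pdivrMr // mul1r ler_nat le_pq andbT divr_gt0 // ltr0n.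
- by move=> j x _; rewrite /line; ring.
Qed.

Variables (n P Q S T D E : nat).
Hypothesis W : farey_weights P Q S T D.
Local Notation a := (E * P + D * S)%N.
Local Notation b := (E * Q + D * T)%N.
Variables (PQ ab : rat).
Hypotheses (numPQ : numq PQ = P) (denPQ : denq PQ = Q).
Hypotheses (numab : numq ab = a) (denab : denq ab = b).
Hypotheses (n_gt0 : (0 < n)%N) (nDE : (n.-1 * D < E)%N).

(** To the right of the corner the two lines coincide; to the left of it, [level_PQ] with c = n
    shows that they have the same lattice points on or above them. *)
Lemma BL_digits_rot : BL_digits R PQ ab n =1 rot_digits a b (n * D).
Proof.
case: (W) => det /andP[T_gt0 TQ] SP ST D_gt0.
have PQE := ratrE_nat numPQ denPQ; have abE := ratrE_nat numab denab.
have dPQ : denn PQ = Q by rewrite /denn denPQ.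
have P_gt0 : (0 < P)%N by nia.
have ltPQ : (P < Q)%N by nia.
have ltab : (a < b)%N by nia.
have Q_gt0 : (0 : R) < Q%:R by rewrite ltr0n; lia.
have b_gt0 : (0 : R) < b%:R by rewrite ltr0n; lia.
pose f := @broken_line R PQ ab n.
have f_left x : x <= (n * Q)%:R -> f x = P%:R / Q%:R * x.
  by rewrite /f /broken_line dPQ -PQE => ->.
have f_right x : (n * Q)%:R <= x -> f x = a%:R / b%:R * (x - (n * Q)%:R) + (n * P)%:R.
  rewrite le_eqVlt => /predU1P[<-|nQx].
    rewrite f_left // subrr mulr0 add0r !natrM mulrCA; congr (_ * _).
    by rewrite mulfVK // gt_eqF.
  rewrite /f /broken_line dPQ leNgt nQx /= abE numPQ; congr (_ + _).
  by rewrite mulnC natrM mulr_natr.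
move=> i; rewrite /BL_digits.
rewrite (@MdigitsE _ f (fun j => if (j < n * Q)%N then P%:R / Q%:R else a%:R / b%:R)).
- apply: level_in_cell_rot => [|x m xi]; first by rewrite (ltnW ltab) andbT; nia.
  have [xnQ|nQx] := leqP x (n * Q).
    rewrite f_left ?ler_nat // mulrAC ler_pdivrMr // [m%:~R * _]mulrC.
    rewrite !pmulrn -!intrM ler_int; apply: (level_PQ W (c := n)); nia.
  rewrite f_right ?ler_nat ?(ltnW nQx) // -lerBrDr mulrAC ler_pdivrMr //.
  rewrite [(_ - _) * b%:R]mulrC !pmulrn -!intrB -!intrM ler_int.
  by apply/idP/idP; nia.
- by rewrite f_left ?mulr0 // ler0n.
- by move=> j; case: ifP => _; rewrite ler_pdivrMr // mul1r ler_nat ltnW // andbT;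
    rewrite divr_gt0 // ltr0n //; nia.
- move=> j x /andP[jx xj]; case: ifPn => [jnQ|]; last first.
    rewrite -leqNgt => nQj; rewrite !f_right ?ler_nat //; first by ring.
    by apply: le_trans jx; rewrite ler_nat.
  rewrite !f_left; [by ring|by rewrite ler_nat ltnW|].
  by apply: le_trans xj _; rewrite ler_nat.
Qed.

End RealDigits.

(** * Unique decomposition into words *)

Section Decoding.
Variables (T : eqType) (c0 c1 : T) (w : T -> seq bool) (v u : seq bool).
Hypotheses (w1E : w c1 = rcons v false ++ w c0) (w0E : w c0 = rcons u true).

Lemma last_flatten_words (z : seq T) : {subset z <= [:: c0; c1]} -> z != [::] ->
  last false (flatten [seq w c | c <- z]) = true.
Proof.
case/lastP: z => // z c zP _; rewrite map_rcons -cats1 flatten_cat /= cats0 last_cat.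
have : c \in [:: c0; c1] by apply: zP; rewrite mem_rcons mem_head.
by rewrite !inE => /orP[] /eqP ->; rewrite ?w1E w0E ?last_cat last_rcons.
Qed.

Lemma cat_injr (U : eqType) (s s1 s2 : seq U) : s1 ++ s = s2 ++ s -> s1 = s2.
Proof.
move=> ss; have /eqP := ss; rewrite eqseq_cat => [/andP[/eqP]|] //.
by have /eqP := congr1 size ss; rewrite !size_cat eqn_add2r => /eqP.
Qed.

(** Two decompositions with different last words would, after removal of the common suffix
    [w c0], equate a word ending with 0 to a concatenation that is empty or ends with 1. *)
Lemma decomposition_unique (z z' : seq T) :
  {subset z <= [:: c0; c1]} -> {subset z' <= [:: c0; c1]} ->
  flatten [seq w c | c <- z] = flatten [seq w c | c <- z'] -> z = z'.
Proof.
have flat_rcons y c : flatten [seq w d | d <- rcons y c] = flatten [seq w d | d <- y] ++ w c.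
  by rewrite map_rcons -cats1 flatten_cat /= cats0.
have nonnil (y : seq T) c : {subset rcons y c <= [:: c0; c1]} ->
    flatten [seq w d | d <- rcons y c] <> [::].
  move=> yP E; have := last_flatten_words yP; rewrite E /=.
  by case: y {E yP} => [|d y] // /(_ isT).
have clash (y y' : seq T) : {subset y' <= [:: c0; c1]} ->
    flatten [seq w d | d <- rcons y c1] <> flatten [seq w d | d <- rcons y' c0].
  move=> y'P; rewrite !flat_rcons w1E catA => /cat_injr E.
  have [y'0|/(last_flatten_words y'P)] := eqVneq y' [::]; last by rewrite -E last_cat last_rcons.
  by have := congr1 size E; rewrite y'0 size_cat size_rcons addnS.
elim/last_ind: z z' => [|z c IHz] z'; case/lastP: z' => [|z' c'] // zP z'P.
- by move/esym/nonnil => /(_ z'P).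
- by move/nonnil => /(_ zP).
have zP0 : {subset z <= [:: c0; c1]} by move=> x xz; apply: zP; rewrite mem_rcons inE xz orbT.
have z'P0 : {subset z' <= [:: c0; c1]} by move=> x xz; apply: z'P; rewrite mem_rcons inE xz orbT.
move=> E; suff [-> ->] : c = c' /\ z = z' by [].
have : c \in [:: c0; c1] by apply: zP; rewrite mem_rcons mem_head.
have : c' \in [:: c0; c1] by apply: z'P; rewrite mem_rcons mem_head.
rewrite !inE => /orP[] /eqP c'E /orP[] /eqP cE; rewrite c'E cE in E *.
- by split=> //; apply: IHz => //; apply: (@cat_injr _ (w c0)); rewrite -!flat_rcons.
- by case: (clash _ _ z'P0 E).
- by case: (clash _ _ zP0 (esym E)).
- by split=> //; apply: IHz => //; apply: (@cat_injr _ (w c1)); rewrite -!flat_rcons.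
Qed.

End Decoding.

(** * The words of P/Q and S/T inside the coding of a/b *)

Section Blocks.
Variables (P Q S T D E : nat).
Hypothesis W : farey_weights P Q S T D.
Hypothesis E_gt0 : (0 < E)%N.
Local Notation a := (E * P + D * S)%N.
Local Notation b := (E * Q + D * T)%N.

Lemma fw_bounds : [/\ (0 < S)%N, (0 < P < Q)%N, (1 < Q)%N & (0 < a < b)%N].
Proof.
case: W => det /andP[T_gt0 TQ] SP ST D_gt0.
have S_gt0 : (0 < S)%N by nia.
have PQ : (0 < P < Q)%N by nia.
by split => //; nia.
Qed.

Lemma rot_digits_PQ rho i : (D <= rho < D + E)%N -> (i < Q)%N ->
  rot_digits a b rho i = rot_digits P Q 0 i.
Proof.
move=> rhoP iQ; have [S_gt0 /andP[P0 PQ] Q1 /andP[a0 ab]] := fw_bounds.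
have lvl (x : nat) (m : int) : (i < x <= i.+2)%N ->
    (a%:Z * x%:Z - rho%:Z <= b%:Z * m) = (P%:Z * x%:Z - 0%:Z <= Q%:Z * m).
  by move=> xi; rewrite subr0 (level_PQ W (c := 1) (E := E) (rho := rho)) ?mul1n //; lia.
have ab' : (0 < a <= b)%N by rewrite a0 ltnW.
have PQ' : (0 < P <= Q)%N by rewrite P0 ltnW.
apply/(rot_levelP rho i.+1 ab')/(rot_levelP 0 i.+1 PQ') => -[m [le_m lt_m]]; exists m;
  move: le_m lt_m; rewrite !ltNge lvl ?lvl //; lia.
Qed.

Lemma rot_digits_ST rho i : (rho < D)%N -> (i < T)%N ->
  rot_digits a b rho i = rot_digits S T 0 i.
Proof.
move=> rhoP iT; have [S_gt0 /andP[P0 PQ] Q1 /andP[a0 ab]] := fw_bounds.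
have lvl (x : nat) (m : int) : (i < x <= i.+2)%N ->
    (a%:Z * x%:Z - rho%:Z <= b%:Z * m) = (S%:Z * x%:Z - 0%:Z <= T%:Z * m).
  by move=> xi; rewrite subr0 (level_ST E W (rho := rho)) //; lia.
have ab' : (0 < a <= b)%N by rewrite a0 ltnW.
have ST' : (0 < S <= T)%N by rewrite S_gt0 (fw_ST W).
apply/(rot_levelP rho i.+1 ab')/(rot_levelP 0 i.+1 ST') => -[m [le_m lt_m]]; exists m;
  move: le_m lt_m; rewrite !ltNge lvl ?lvl //; lia.
Qed.

(** Drawn backwards from a common end point, the lines of slopes P/Q and S/T are first separated
    by the lattice point T steps to the left and S steps down, so the last T digits agree. *)
Lemma rot_digits_suffix i : (i < T)%N ->
  rot_digits P Q 0 (Q - T + i) = rot_digits S T 0 i.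
Proof.
move=> iT; have [S_gt0 /andP[P0 PQ] Q1 /andP[a0 ab]] := fw_bounds.
case: (W) => det /andP[T_gt0 TQ] SP ST D_gt0.
have lvl (x : nat) (m : int) : (i < x <= i.+2)%N ->
    (P%:Z * ((Q - T) + x)%N%:Z - 0%:Z <= Q%:Z * (m + (P%:Z - S%:Z))) =
    (S%:Z * x%:Z - 0%:Z <= T%:Z * m).
  move=> xi; rewrite !subr0.
  pose j := Q%:Z * m - P%:Z * x%:Z; pose l := T%:Z * m - S%:Z * x%:Z.
  have xE : x%:Z = T%:Z * j - Q%:Z * l by rewrite /j /l; nia.
  (* Moving the origin to (Q - T, P - S), where Qm - Px takes the value -1, turns
     the condition Qm - Px >= 0 into j >= 1. *)
  have -> : (P%:Z * ((Q - T) + x)%N%:Z <= Q%:Z * (m + (P%:Z - S%:Z))) = (1 <= j).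
    have detZ : S%:Z * Q%:Z = P%:Z * T%:Z + 1 by lia.
    have : Q%:Z * (m + (P%:Z - S%:Z)) - P%:Z * ((Q - T) + x)%N%:Z = j - 1.
      by rewrite PoszD -subzn ?(ltnW TQ) // /j; lia.
    by lia.
  have -> : (S%:Z * x%:Z <= T%:Z * m) = (0 <= l) by rewrite /l; lia.
  by apply/idP/idP => h; rewrite leNgt; apply/negP => h'; nia.
have PQ' : (0 < P <= Q)%N by rewrite P0 ltnW.
have ST' : (0 < S <= T)%N by rewrite S_gt0 (fw_ST W).
apply/(rot_levelP 0 _ PQ')/(rot_levelP 0 i.+1 ST') => -[m [le_m lt_m]].
  have h1 : (i < i.+1 <= i.+2)%N by lia.
  have h2 : (i < i.+2 <= i.+2)%N by lia.
  exists (m - (P%:Z - S%:Z)); rewrite -lvl // subrK addnS; split=> //.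
  by rewrite ltNge -lvl // subrK !addnS -ltNge.
have h1 : (i < i.+1 <= i.+2)%N by lia.
have h2 : (i < i.+2 <= i.+2)%N by lia.
exists (m + (P%:Z - S%:Z)); rewrite -addnS lvl //; split=> //.
by rewrite -addnS ltNge lvl // -ltNge.
Qed.

(** The residue at this place is Q - 1, the largest one, as (Q-P)(Q-T) = -1 mod Q. *)
Lemma rot_digits_before_suffix : rot_digits P Q 0 (Q - T).-1 = false.
Proof.
have [S_gt0 /andP[P0 PQ] Q1 /andP[a0 ab]] := fw_bounds.
case: (W) => det /andP[T_gt0 TQ] SP ST D_gt0.
rewrite /rot_digits prednK ?subn_gt0 // /rot_orbit add0n.
have -> : ((Q - P) * (Q - T) = (Q - T - (P - S)).-1 * Q + Q.-1)%N.
  have [[A PE] [B QE]] : (exists A, P = A + S)%N /\ (exists B, Q = B + T)%N.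
    by split; [exists (P - S)%N|exists (Q - T)%N]; lia.
  have detB : (S * B = A * T + 1)%N by move: det; rewrite PE QE; lia.
  have [c BE] : exists c, (B = A.+1 + c)%N by exists (B - A.+1)%N; nia.
  have [e TE] : exists e, (T = S + e)%N by exists (T - S)%N; lia.
  (* With these variables the determinant condition becomes e B = (c + 1) T - 1. *)
  rewrite PE QE !addnK BE (_ : (_ + _ - A).-1 = c)%N; last by lia.
  rewrite (_ : _ - (A + S) = e + c.+1)%N; last by lia.
  rewrite (_ : (_ + _ + T).-1 = A + c + T)%N; last by lia.
  by nia.
by rewrite modnMDl modn_small; lia.
Qed.

Lemma rot_digits_last : rot_digits S T 0 T.-1 = true.
Proof.
have [S_gt0 _ _ _] := fw_bounds; case: (W) => det /andP[T_gt0 TQ] SP ST D_gt0.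
by rewrite /rot_digits prednK // /rot_orbit add0n modnMl.
Qed.

Definition word_PQ := mkseq (rot_digits P Q 0) Q.
Definition word_ST := mkseq (rot_digits S T 0) T.

Lemma word_STE : exists u, word_ST = rcons u true.
Proof.
exists (mkseq (rot_digits S T 0) T.-1); rewrite -rot_digits_last -mkseqS prednK //.
by case/andP: (fw_T W).
Qed.

Lemma mkseq_add (U : Type) (f : nat -> U) p q :
  mkseq f (p + q) = mkseq f p ++ mkseq (fun i => f (p + i)%N) q.
Proof. by rewrite /mkseq iotaD map_cat add0n -{2}[p]addn0 iotaDl -map_comp. Qed.

Lemma word_PQE : exists v, word_PQ = rcons v false ++ word_ST.
Proof.
have /andP[T_gt0 TQ] := fw_T W.
exists (mkseq (rot_digits P Q 0) (Q - T).-1).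
rewrite -rot_digits_before_suffix -mkseqS prednK ?subn_gt0 //.
rewrite /word_PQ -{2}(subnK (ltnW TQ)) mkseq_add; congr (_ ++ _).
by apply/eq_in_map => i; rewrite mem_iota => /andP[_ iT]; apply: rot_digits_suffix.
Qed.

End Blocks.

(** * First returns of the rotation to [0, D+E) *)

Section Decomposition.
Variables (n P Q S T D E : nat).
Hypothesis W : farey_weights P Q S T D.
Hypotheses (n_gt0 : (0 < n)%N) (nDE : (n.-1 * D < E)%N).
Local Notation a := (E * P + D * S)%N.
Local Notation b := (E * Q + D * T)%N.
Let E_gt0 : (0 < E)%N := leq_ltn_trans (leq0n _) nDE.
Local Notation k := (n * D)%N.
Local Notation M := (D + E)%N.

Lemma k_lt_DE : (k < M)%N.
Proof. by rewrite -(prednK n_gt0) mulSn ltn_add2l. Qed.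

Lemma DE_le_a : (M <= a)%N.
Proof.
have [S_gt0 /andP[P_gt0 _] _ _] := fw_bounds W E_gt0.
by rewrite addnC leq_add // leq_pmulr.
Qed.

Let D_lt_DE : (D < M)%N.
Proof. by rewrite -[X in (X < _)%N]addn0 ltn_add2l. Qed.

(** The induced map, an exchange of intervals of lengths D and E, is itself a rotation of
    Z/(D+E), by -D.  Its orbit from k lists the residues at which the words begin. *)
Definition block_pos (j : nat) : nat := rot_orbit D M k j.
Definition block_size (j : nat) : nat := if (block_pos j < D)%N then T else Q.
Definition block_start (j : nat) : nat := (\sum_(i < j) block_size i)%N.

Lemma block_startS j : block_start j.+1 = (block_start j + block_size j)%N.
Proof. by rewrite /block_start big_ord_recr. Qed.

Lemma block_posS j :
  block_pos j.+1 = if (block_pos j < D)%N then (block_pos j + E)%N else (block_pos j - D)%N.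
Proof. by rewrite /block_pos rotS // addKn. Qed.

Lemma block_pos_lt j : (block_pos j < M)%N.
Proof. exact: rot_lt. Qed.

(** T rotation steps add -aT = E mod b, and Q steps add -aQ = -D mod b. *)
Lemma rot_block_start j : rot_orbit a b k (block_start j) = block_pos j.
Proof.
have [S_gt0 /andP[P0 PQ] Q1 /andP[a0 ab]] := fw_bounds W E_gt0.
case: (W) => det /andP[T_gt0 TQ] SP ST D_gt0.
elim: j => [|j IHj].
  rewrite /block_start big_ord0 /block_pos !rot0 ?k_lt_DE //.
  exact: ltn_trans (leq_trans k_lt_DE DE_le_a) ab.
rewrite block_startS rotD IHj block_posS /block_size.
have := block_pos_lt j; set rho := block_pos j => rhoM.
case: ltnP => rhoD.
  have -> : (rho + (b - a) * T = (T - S) * b + (rho + E))%N.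
    rewrite !mulnBl.
    have : (S * b <= T * b)%N by rewrite leq_mul2r ST orbT.
    have : (a * T <= b * T)%N by rewrite leq_mul2r (ltnW ab) orbT.
    have : (S * b = a * T + E)%N by nia.
    lia.
  by rewrite modnMDl modn_small //; have := DE_le_a; lia.
have -> : (rho + (b - a) * Q = (Q - P) * b + (rho - D))%N.
  rewrite !mulnBl.
  have : (P * b <= Q * b)%N by rewrite leq_mul2r (ltnW PQ) orbT.
  have : (a * Q <= b * Q)%N by rewrite leq_mul2r (ltnW ab) orbT.
  have : (a * Q = P * b + D)%N by nia.
  lia.
by rewrite modnMDl modn_small //; have := DE_le_a; lia.
Qed.

Lemma block_start_mono i j : (i < j)%N -> (block_start i < block_start j)%N.
Proof.
case: (W) => det /andP[T_gt0 TQ] SP ST D_gt0.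
elim: j => // j IHj; rewrite ltnS leq_eqVlt block_startS /block_size => /predU1P[->|/IHj];
  case: ifP => _; lia.
Qed.

Section Labels.
Variables (C : eqType) (c0 c1 : C) (w : C -> seq bool).
Hypotheses (c01 : c0 != c1) (w0 : w c0 = word_ST S T) (w1 : w c1 = word_PQ P Q).

Definition block_label (j : nat) : C := if (block_pos j < D)%N then c0 else c1.

Lemma flatten_blocks j : flatten [seq w c | c <- mkseq block_label j] =
  mkseq (rot_digits a b k) (block_start j).
Proof.
elim: j => [|j IHj]; first by rewrite /block_start big_ord0.
rewrite mkseqS map_rcons -cats1 flatten_cat IHj block_startS mkseq_add /= cats0; congr (_ ++ _).
have digitE i : rot_digits a b k (block_start j + i) = rot_digits a b (block_pos j) i.
  by rewrite /rot_digits -addnS rotD rot_block_start /rot_orbit.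
have rhoM := block_pos_lt j.
rewrite /block_label /block_size; case: ltnP => rhoD; rewrite ?w0 ?w1;
  apply/esym/eq_in_map => i; rewrite mem_iota => /andP[_ iT]; rewrite digitE.
  by apply: rot_digits_ST.
by apply: rot_digits_PQ => //; rewrite rhoD.
Qed.

(** Every word labelled [c1] lowers the residue by D, until it drops below D. *)
Lemma block_run j s :
  (forall t, (t < s)%N -> block_label (j + t) = c1) /\ block_label (j + s) = c0 <->
  (s * D <= block_pos j < s.+1 * D)%N.
Proof.
have labelP i : (block_label i == c0) = (block_pos i < D)%N.
  by rewrite /block_label; case: ifP => _; rewrite ?eqxx // eq_sym (negbTE c01).
have label1 i : (block_label i = c1) <-> (D <= block_pos i)%N.
  rewrite /block_label; case: ltnP => h; split=> // E1.
  by move: c01; rewrite E1 eqxx.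
elim: s j => [|s IHs] j.
  rewrite addn0 mul0n mul1n /= -labelP; split=> [[_ ->]|/eqP //]; first by rewrite eqxx.
rewrite addnS -addSn; split.
  move=> [run_c1 end_c0].
  have /label1 Dj : block_label j = c1 by rewrite -(addn0 j) run_c1.
  have /IHs : (forall t, (t < s)%N -> block_label (j.+1 + t) = c1) /\ block_label (j.+1 + s) = c0.
    by split=> // t ts; rewrite addSnnS run_c1.
  rewrite block_posS ltnNge Dj /= !mulSn; lia.
move=> /andP[le_rho lt_rho]; rewrite mulSn in le_rho; rewrite mulSn in lt_rho.
have Dj : (D <= block_pos j)%N by apply: leq_trans le_rho; rewrite leq_addr.
have /IHs[run_c1 end_c0] : (s * D <= block_pos j.+1 < s.+1 * D)%N.
  by rewrite block_posS ltnNge Dj /=; lia.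
split=> // -[|t] ts; first by rewrite addn0; apply/label1.
by rewrite -addSnnS; apply: run_c1.
Qed.

End Labels.

Hypothesis ab_coprime : coprime a b.

Lemma coprime_DE : coprime D M.
Proof.
rewrite /coprime gcdnDl -dvdn1 -(eqP ab_coprime) dvdn_gcd.
by rewrite !dvdn_add ?dvdn_mulr ?dvdn_gcdl ?dvdn_gcdr.
Qed.

(** Over D + E words every residue below D + E occurs once, so D of the words have length T and
    E of them have length Q. *)
Lemma block_start_total : block_start M = b.
Proof.
pose h (i : 'I_M) : 'I_M := Ordinal (block_pos_lt i).
have h_inj : injective h.
  move=> i j /(congr1 val)/eqP; rewrite /= rot_orbit_eq ?coprime_DE //.
  by rewrite !modn_small // => /eqP /val_inj.
rewrite /block_start (eq_bigr (fun i => if (h i < D)%N then T else Q)) //.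
rewrite -(reindex_inj (P := xpredT) (F := fun i : 'I_M => if (i < D)%N then T else Q) h_inj) /=.
rewrite big_split_ord /= (eq_bigr (fun=> T)) => [|i _]; last by rewrite ltn_ord.
rewrite [X in (_ + X)%N](eq_bigr (fun=> Q)) => [|i _]; last by rewrite ltnNge leq_addr.
by rewrite !sum_nat_const !card_ord addnC.
Qed.

Lemma block_label_period (C : eqType) (c0 c1 : C) j :
  block_label c0 c1 (j %% M) = block_label c0 c1 j.
Proof.
rewrite /block_label /block_pos (_ : rot_orbit _ _ _ (j %% M) = rot_orbit D M k j) //.
by apply/eqP; rewrite rot_orbit_eq ?coprime_DE // modn_mod.
Qed.

End Decomposition.

(** * Recovering the data from the coding *)

Section Uniqueness.

(** If k - 1 + t lies in [0, k] modulo b but k + t does not, then k - 1 + t is congruent to k. *)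
Lemma add_mod_crossing (b k t : nat) : (0 < k < b)%N -> (t < b)%N ->
  ((k.-1 + t) %% b <= k)%N -> (k < (k + t) %% b)%N -> t = 1%N.
Proof.
move=> /andP[k_gt0 kb] tb stay_k exit_k; have [kt|kt] := ltnP (k.-1 + t)%N b.
  rewrite modn_small // in stay_k.
  have [t0|] := posnP t; last by lia.
  by rewrite t0 addn0 modn_small ?ltnn in exit_k.
have ktE : (k + t = (k + t - b) + b)%N by lia.
by rewrite ktE modnDr modn_small in exit_k; lia.
Qed.

(** Let h steps of the second rotation be the translation by 1.  It leaves the set of residues
    at most k' only from k'.  The same times form the set of residues at most k of the first
    rotation, where h steps are the translation by some t; it therefore keeps k - 1 inside
    and moves k out, which forces t = 1.  Equal inverses of b - a and b - a' mod b then give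
    a = a'. *)
Lemma rot_coding_slope (a b k a' k' : nat) :
  (0 < k < a)%N -> (a < b)%N -> coprime a b ->
  (k' < a')%N -> (a' < b)%N -> coprime a' b ->
  (forall x, (0 < x)%N -> (rot_orbit a b k x < k)%N = (rot_orbit a' b k' x < k')%N) ->
  (forall x, (0 < x)%N -> (rot_orbit a b k x == k) = (rot_orbit a' b k' x == k')) ->
  a = a'.
Proof.
move=> /andP[k_gt0 ka] ab cop ka' ab' cop' lt_eq eq_eq.
have b_gt0 : (0 < b)%N by lia.
have [h hE] := coprime_inv b_gt0 (coprime_subl (ltnW ab') cop').
pose t := ((b - a) * h %% b)%N; have tb : (t < b)%N by rewrite ltn_mod.
have rh y : rot_orbit a b k (y + h) = ((rot_orbit a b k y + t) %% b)%N.
  by rewrite rotD modnDmr.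
have rh' y : rot_orbit a' b k' (y + h) = ((rot_orbit a' b k' y + 1) %% b)%N.
  by rewrite rotD -modnDmr hE modnDmr.
(* At time b both residues are the initial ones. *)
have exit_k : (k < (k + t) %% b)%N.
  have rb : rot_orbit a b k b = k by apply/eqP; rewrite rot_eq_start // (ltn_trans ka).
  have rb' : rot_orbit a' b k' b = k' by apply/eqP; rewrite -eq_eq // rb.
  rewrite -{2}rb -rh ltn_neqAle leqNgt eq_sym eq_eq ?lt_eq ?addn_gt0 ?b_gt0 //.
  by rewrite rh' rb' modn_small ?addn1 ?ltnS; lia.
have stay_k : ((k.-1 + t) %% b <= k)%N.
  have k1b : (k.-1 < b)%N by lia.
  have [y ry] := rot_hit k ab cop 1 k1b.
  have ry' : (rot_orbit a' b k' (1 + y) < k')%N by rewrite -lt_eq // ry; lia.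
  rewrite -ry -rh leq_eqVlt lt_eq ?eq_eq ?addn_gt0 // rh'.
  by rewrite modn_small ?addn1; lia.
have t1 : t = 1%N by apply: add_mod_crossing tb stay_k exit_k; rewrite k_gt0 (ltn_trans ka).
have : ((b - a) * ((b - a') * h) = (b - a') * ((b - a) * h) %[mod b])%N by rewrite mulnCA.
rewrite -modnMmr hE modnMmr muln1 -[in RHS]modnMmr -/t t1 muln1.
have [a_gt0 a'_gt0] : (0 < a)%N /\ (0 < a')%N.
  by rewrite (leq_ltn_trans _ ka) ?(leq_ltn_trans _ ka').
rewrite !modn_small ?ltn_subrL ?b_gt0 ?andbT //.
by move: ab ab'; clear; lia.
Qed.

(** The two orbits differ by the constant k - k'.  If k' < k, then at a time when the first
    residue is 0 the second one is b - (k - k'), which is at least k'. *)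
Lemma rot_coding_threshold (a b k k' : nat) : (a < b)%N -> coprime a b -> (0 < k < b)%N ->
  (forall x, (0 < x)%N -> (rot_orbit a b k x < k)%N -> (rot_orbit a b k' x < k')%N) ->
  (k <= k')%N.
Proof.
move=> ab cop /andP[k_gt0 kb] lt_imp; rewrite leqNgt; apply/negP => k'k.
have b_gt0 : (0 < b)%N by lia.
have [y ry] := rot_hit k ab cop 1 b_gt0.
have ry' : (rot_orbit a b k' (1 + y) < k')%N by apply: lt_imp; rewrite ?ry.
have : rot_orbit a b k (1 + y) = ((rot_orbit a b k' (1 + y) + (k - k')) %% b)%N.
  by rewrite /rot_orbit modnDml; congr (_ %% _)%N; lia.
by rewrite ry modn_small; lia.
Qed.

(** If (q, p) has coordinates x and y in the basis (Q, P), (T, S), then qa - pb = xD - yE.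
    A value strictly between -E and D together with q > 0 needs both coordinates positive:
    every other pattern of signs violates one of the three inequalities. *)
Lemma farey_gap (P Q S T D E : nat) (p q : int) : (S * Q = P * T + 1)%N ->
  0 < q -> - E%:Z < q * (E * P + D * S)%N%:Z - p * (E * Q + D * T)%N%:Z < D%:Z ->
  (Q + T)%N%:Z <= q.
Proof.
move=> det q_gt0.
pose x := q * S%:Z - p * T%:Z; pose y := Q%:Z * p - P%:Z * q.
have detZ : S%:Z * Q%:Z = P%:Z * T%:Z + 1 by lia.
have qE : q = x * Q%:Z + y * T%:Z.
  have -> : x * Q%:Z + y * T%:Z = q * (S%:Z * Q%:Z - P%:Z * T%:Z) by rewrite /x /y; ring.
  by rewrite detZ; ring.
have -> : q * (E * P + D * S)%N%:Z - p * (E * Q + D * T)%N%:Z = x * D%:Z - y * E%:Z.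
  by rewrite /x /y !PoszD !PoszM; ring.
move=> /andP[lo hi].
have x_ge1 : 1 <= x.
  rewrite leNgt; apply/negP => x0.
  have [y0|y0] := leP y 0; first by nia.
  by nia.
have y_ge1 : 1 <= y by rewrite leNgt; apply/negP => y0; nia.
by nia.
Qed.

(** As P'/Q' has the value D' < D, [farey_gap] for (P/Q, S/T) gives Q' >= Q + T.  If D < D' + E',
    then the same lemma for the neighbors (P'-S')/(Q'-T') and S'/T', whose values are D' + E'
    and -E', gives Q >= Q', a contradiction.  So D' + E' <= D, and n'D' < D' + E'. *)
Lemma threshold_lt (n P Q S T D E n' P' Q' S' T' D' E' : nat) :
  farey_weights P Q S T D -> farey_weights P' Q' S' T' D' -> (0 < n)%N -> (0 < n')%N ->
  (n'.-1 * D' < E')%N ->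
  (E * P + D * S = E' * P' + D' * S')%N -> (E * Q + D * T = E' * Q' + D' * T')%N ->
  (D' < D)%N -> (0 < E)%N -> (n' * D' < n * D)%N.
Proof.
move=> [det /andP[T0 TQ] SP ST D0] [det' /andP[T0' TQ'] SP' ST' D0'] n0 n0' nDE' aE bE DD E0.
have Q'_ge : (Q + T <= Q')%N.
  rewrite -lez_nat; apply: (@farey_gap P Q S T D E P'%:Z) => //; first by lia.
  rewrite aE bE (_ : _ - _ = D'%:Z); first by lia.
  have : S'%:Z * Q'%:Z = P'%:Z * T'%:Z + 1 by lia.
  rewrite !PoszD !PoszM; nia.
have DE' : (D' + E' <= D)%N.
  rewrite leqNgt; apply/negP => DDE.
  have : (Q' <= Q)%N; last by lia.
  rewrite -(subnK (ltnW TQ')) -lez_nat.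
  apply: (@farey_gap (P' - S') (Q' - T') S' T' (D' + E') E' P%:Z); [|lia|].
    by rewrite mulnBr mulnBl; nia.
  have -> : (E' * (P' - S') + (D' + E') * S' = E * P + D * S)%N by rewrite aE mulnBr; nia.
  have -> : (E' * (Q' - T') + (D' + E') * T' = E * Q + D * T)%N by rewrite bE mulnBr; nia.
  rewrite (_ : _ - _ = D%:Z); first by lia.
  have : S%:Z * Q%:Z = P%:Z * T%:Z + 1 by lia.
  rewrite !PoszD !PoszM; nia.
have : (D <= n * D)%N by rewrite leq_pmull.
by rewrite -(prednK n0') mulSn; lia.
Qed.

Lemma eq_of_small_diff (q t t' : nat) (z : int) :
  (t < q)%N -> (t' < q)%N -> t%:Z - t'%:Z = q%:Z * z -> t = t'.
Proof.
move=> tq tq' zE.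
have [z0|z0] := lerP 1 z; first by have : q%:Z * 1 <= q%:Z * z; [rewrite ler_wpM2l|lia].
have [z1|z1] := lerP z (-1); first by have : q%:Z * z <= q%:Z * (-1); [rewrite ler_wpM2l|lia].
have zz : z = 0 by lia.
by move: zE; rewrite zz; lia.
Qed.

(** Modulo b, Q is the only solution of aQ = D; then P follows, and T is determined modulo Q
    by PT = -1. *)
Lemma farey_weights_unique (P Q S T D E P' Q' S' T' E' : nat) :
  farey_weights P Q S T D -> farey_weights P' Q' S' T' D -> (0 < E)%N -> (0 < E')%N ->
  (E * P + D * S = E' * P' + D * S')%N -> (E * Q + D * T = E' * Q' + D * T')%N ->
  coprime (E * P + D * S) (E * Q + D * T) ->
  [/\ P = P', Q = Q', S = S' & T = T'].
Proof.
move=> W W' E0 E0' aE bE cop.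
have [S_gt0 /andP[P0 PQ] Q1 /andP[a0 ab]] := fw_bounds W E0.
have [S_gt0' /andP[P0' PQ'] Q1' _] := fw_bounds W' E0'.
case: (W) (W') => [det /andP[T0 TQ] SP ST D0] [det' /andP[T0' TQ'] SP' ST' _].
set a := (E * P + D * S)%N in aE cop a0 ab *; set b := (E * Q + D * T)%N in bE cop ab *.
have DE : (a * Q = b * P + D)%N by rewrite /a /b; nia.
have DE' : (a * Q' = b * P' + D)%N by rewrite aE bE; nia.
have lt_comb e q d t : (0 < e)%N -> (0 < d)%N -> (0 < t)%N -> (q < e * q + d * t)%N.
  by move=> e0 d0 t0; rewrite -addn1 leq_add ?leq_pmull ?muln_gt0 ?d0.
have Qb : (Q < b)%N by apply: lt_comb.
have Qb' : (Q' < b)%N by rewrite bE; apply: lt_comb.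
have hit q p : (p < q)%N -> (a * q = b * p + D)%N -> rot_orbit a b D q = 0%N.
  move=> pq h; rewrite /rot_orbit (_ : _ + _ = (q - p) * b)%N ?modnMl //.
  have : (p * b <= q * b)%N by rewrite leq_mul2r (ltnW pq) orbT.
  have : (a * q <= b * q)%N by rewrite leq_mul2r (ltnW ab) orbT.
  by rewrite !mulnBl; lia.
have QQ : Q = Q'.
  have /eqP : rot_orbit a b D Q = rot_orbit a b D Q' by rewrite (hit _ P) ?(hit _ P').
  by rewrite rot_orbit_eq // !modn_small // => /eqP.
subst Q'.
have PP : P = P'.
  have /eqP : (b * P = b * P')%N by lia.
  by rewrite eqn_pmul2l => [/eqP|]; lia.
subst P'.
(* the quotient of T - T' by Q, from Q(S - S') = P(T - T') and QS - PT = 1 *)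
pose z := S%:Z * (T%:Z - T'%:Z) - T%:Z * (S%:Z - S'%:Z).
have zE : T%:Z - T'%:Z = Q%:Z * z by rewrite /z; nia.
have TT : T = T' := eq_of_small_diff TQ TQ' zE.
subst T'; split=> //.
have /eqP : (S * Q = S' * Q)%N by lia.
by rewrite eqn_pmul2r => [/eqP|]; lia.
Qed.

End Uniqueness.

(** * Integer data of a broken line *)

Section RationalData.

Record BL_weights (n : nat) (PQ ab ST : rat) (P Q S T D E : nat) : Prop := BLWeights {
  blw_farey : farey_weights P Q S T D;
  blw_n : (0 < n)%N;
  blw_E : (n.-1 * D < E)%N;
  blw_numPQ : numq PQ = P;
  blw_denPQ : denq PQ = Q;
  blw_numST : numq ST = S;
  blw_denST : denq ST = T;
  blw_numab : numq ab = (E * P + D * S)%N;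
  blw_denab : denq ab = (E * Q + D * T)%N }.

Lemma ltq_ratio (x y z t : int) : 0 < y -> 0 < t ->
  (x%:~R / y%:~R < z%:~R / t%:~R :> rat) = (x * t < z * y).
Proof.
move=> y0 t0; rewrite ltr_pdivrMr ?ltr0z // mulrAC ltr_pdivlMr ?ltr0z //.
by rewrite -!intrM ltr_int.
Qed.

Lemma numq_denq_nat (r : rat) : 0 <= r -> exists p q : nat,
  [/\ numq r = p, denq r = q, (0 < q)%N & r = p%:~R / q%:~R].
Proof.
move=> r_ge0; have d0 := denq_gt0 r; exists `|numq r|%N, `|denq r|%N.
have nE : numq r = `|numq r|%N by rewrite gez0_abs // numq_ge0.
have dE : denq r = `|denq r|%N by rewrite gez0_abs // ltW.
split=> //; first by lia.
by rewrite -nE -dE divq_num_den.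
Qed.

Lemma farey_weights_exist (n A B S T a b : nat) : (0 < B)%N -> (0 < T)%N -> (S <= T)%N ->
  (S * B = A * T + 1)%N -> ((A + S) * b < a * (B + T))%N ->
  (a * (n.-1 * (B + T) + T) < b * (n.-1 * (A + S) + S))%N ->
  exists D E, [/\ farey_weights (A + S) (B + T) S T D, (n.-1 * D < E)%N,
    a = (E * (A + S) + D * S)%N & b = (E * (B + T) + D * T)%N].
Proof.
move=> B0 T0 ST det PQab abit.
have [D DE] : exists D, (a * (B + T) = (A + S) * b + D)%N.
  by exists (a * (B + T) - (A + S) * b)%N; rewrite subnKC // ltnW.
have nDE : (a * T + n.-1 * D < b * S)%N by move: abit DE; clear; nia.
have [E EE] : exists E, (b * S = a * T + E)%N.
  by exists (b * S - a * T)%N; rewrite subnKC // ltnW // (leq_ltn_trans _ nDE) // leq_addr.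
exists D, E; split.
- by split; rewrite ?leq_addl //; [move: det; clear|rewrite T0|]; lia.
- by lia.
- by move: det DE EE; clear; nia.
- by move: det DE EE; clear; nia.
Qed.

Lemma BL_data_weights n AB PQ ab ST : BL_data n AB PQ ab ST ->
  exists P Q S T D E, BL_weights n PQ ab ST P Q S T D E.
Proof.
move=> [n_gt0 [AB_ST det] [AB_ge0 AB_PQ PQ_ab ab_it] [_ ST_le1] PQE].
have ST_ge0 : 0 <= ST by apply: le_trans AB_ge0 (ltW AB_ST).
have PQ_ge0 : 0 <= PQ by apply: le_trans AB_ge0 (ltW AB_PQ).
have ab_ge0 : 0 <= ab by apply: le_trans PQ_ge0 (ltW PQ_ab).
have [A [B [nAB dAB B0 _]]] := numq_denq_nat AB_ge0.
have [S [T [nST dST T0 STE]]] := numq_denq_nat ST_ge0.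
have [a [b [nab dab b0 abE]]] := numq_denq_nat ab_ge0.
have {}det : (S * B = A * T + 1)%N by move: det; rewrite nAB dAB nST dST; lia.
have cop_med : coprime (A + S) (B + T).
  rewrite coprime_sym; apply/coprimeP; first by lia.
  by exists (S, T) => /=; lia.
have PQE' : PQ = (A + S)%N%:~R / (B + T)%N%:~R.
  by rewrite PQE /mediant nAB dAB nST dST !PoszD.
have nPQ : numq PQ = (A + S)%N by rewrite PQE' coprimeq_num // gtr0_sg ?mul1r //; lia.
have dPQ : denq PQ = (B + T)%N by rewrite PQE' coprimeq_den //; case: eqP; lia.
have ST1 : (S <= T)%N.
  by move: ST_le1; rewrite STE ler_pdivrMr ?ltr0z // mul1r ler_int.
have PQab : ((A + S) * b < a * (B + T))%N.
  have d_gt0 : 0 < (B + T)%N%:Z by rewrite ltz_nat addn_gt0 B0.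
  by move: PQ_ab; rewrite PQE' abE ltq_ratio // -!PoszM ltz_nat.
have abit : (a * (n.-1 * (B + T) + T) < b * (n.-1 * (A + S) + S))%N.
  have mulrnE (x y : nat) : x%:Z *+ n.-1 + y%:Z = (n.-1 * x + y)%N%:Z.
    by rewrite -mulr_natl natz PoszD PoszM.
  move: ab_it; rewrite /iter_mediant nPQ dPQ nST dST abE !mulrnE.
  have d_gt0 : 0 < (n.-1 * (B + T) + T)%N%:Z by rewrite ltz_nat addn_gt0 T0 orbT.
  by rewrite ltq_ratio // -!PoszM ltz_nat [ltnRHS]mulnC.
have [D [E [W nDE aE bE]]] := farey_weights_exist B0 T0 ST1 det PQab abit.
exists (A + S)%N, (B + T)%N, S, T, D, E; split=> //; first by rewrite nab aE.
by rewrite dab bE.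
Qed.

End RationalData.

(** * The kneading sequence of a broken line *)

Section BrokenLine.
Variables (R : realType) (n : nat) (PQ ab ST : rat) (P Q S T D E : nat).
Hypothesis B : BL_weights n PQ ab ST P Q S T D E.
Local Notation a := (E * P + D * S)%N.
Local Notation b := (E * Q + D * T)%N.
Local Notation k := (n * D)%N.
Local Notation theta := (BL_theta R PQ ab n).

Let W : farey_weights P Q S T D := blw_farey B.
Let E_gt0 : (0 < E)%N := leq_ltn_trans (leq0n _) (blw_E B).

Lemma BL_coprime : coprime a b.
Proof. by have := coprime_num_den ab; rewrite (blw_numab B) (blw_denab B). Qed.

Lemma BL_threshold : (0 < k < a)%N.
Proof.
rewrite muln_gt0 (blw_n B) (fw_D W) /=.
exact: leq_trans (k_lt_DE (blw_n B) (blw_E B)) (DE_le_a W (blw_E B)).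
Qed.

Lemma BL_lt : (a < b)%N.
Proof. by have [_ _ _ /andP[]] := fw_bounds W E_gt0. Qed.

Lemma BL_denn : denn ab = b.
Proof. by rewrite /denn (blw_denab B). Qed.

Lemma BL_digitsE : BL_digits R PQ ab n =1 rot_digits a b k.
Proof.
exact: (BL_digits_rot R W (blw_numPQ B) (blw_denPQ B) (blw_numab B) (blw_denab B)
  (blw_n B) (blw_E B)).
Qed.

Lemma BL_thetaE : theta = orbit_value R a b k 1.
Proof. by rewrite /BL_theta (funext BL_digitsE). Qed.

Lemma BL_kneading i : kneading theta i =
  if (rot_orbit a b k i.+1 < k)%N then K0 else if rot_orbit a b k i.+1 == k then Kstar else K1.
Proof.
by have /andP[_ ka] := BL_threshold; rewrite BL_thetaE kneading_orbit // ?BL_lt ?BL_coprime.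
Qed.

Lemma BL_kneading_star i : kneading theta i = Kstar <-> (b %| i.+1)%N.
Proof.
have /andP[_ ka] := BL_threshold; have kb := ltn_trans ka BL_lt.
rewrite -(rot_eq_start BL_lt BL_coprime kb) BL_kneading.
by case: ltngtP.
Qed.

Lemma Mword_PQ : Mword R PQ = word_PQ P Q.
Proof.
have [_ /andP[P_gt0 PQlt] _ _] := fw_bounds W E_gt0.
rewrite /Mword /denn (blw_denPQ B); apply/eq_mkseq => i.
by apply: line_digits; rewrite ?(blw_numPQ B) ?(blw_denPQ B) // P_gt0 ltnW.
Qed.

Lemma Mword_ST : Mword R ST = word_ST S T.
Proof.
have [S_gt0 _ _ _] := fw_bounds W E_gt0.
rewrite /Mword /denn (blw_denST B); apply/eq_mkseq => i.
by apply: line_digits; rewrite ?(blw_numST B) ?(blw_denST B) // S_gt0 (fw_ST W).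
Qed.

Lemma ST_neq_PQ : ST != PQ.
Proof.
have /andP[_ TQ] := fw_T W; apply/negP => /eqP E1.
by have := blw_denST B; rewrite E1 (blw_denPQ B) => -[QT]; rewrite QT ltnn in TQ.
Qed.

Definition BL_blocks : seq rat := mkseq (block_label n D E ST PQ) (D + E).

Lemma BL_blocksP : Mdecomposition R PQ ab ST n BL_blocks.
Proof.
split; first by rewrite size_mkseq addn_gt0 E_gt0 orbT.
  move=> z /mapP[j _ ->]; rewrite /block_label !inE.
  by case: ifP; rewrite eqxx ?orbT.
rewrite (flatten_blocks W (blw_n B) (blw_E B) Mword_ST Mword_PQ).
rewrite (block_start_total (blw_E B) BL_coprime) BL_denn.
by apply/eq_mkseq => i; rewrite BL_digitsE.
Qed.

Lemma BL_blocks_unique zeta : Mdecomposition R PQ ab ST n zeta -> zeta = BL_blocks.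
Proof.
move=> [_ zP zE]; have [_ yP yE] := BL_blocksP.
have [u uE] := word_STE W E_gt0; have [v vE] := word_PQE W E_gt0.
apply: (decomposition_unique (w := Mword R) (v := v) (u := u) _ _ zP yP).
- by rewrite Mword_PQ Mword_ST.
- by rewrite Mword_ST.
- by rewrite zE yE.
Qed.

Lemma starts_string_blocks s i :
  starts_string R PQ ST BL_blocks s i <->
  exists2 j, (j < D + E)%N /\ i = block_start n Q T D E j &
    (s * D <= block_pos n D E j < s.+1 * D)%N.
Proof.
have nth_blocks j t : nth 0 BL_blocks ((j + t) %% (D + E)) = block_label n D E ST PQ (j + t).
  rewrite nth_mkseq ?ltn_mod ?addn_gt0 ?E_gt0 ?orbT //.
  by rewrite (block_label_period (blw_E B) BL_coprime).
have startE j : (j < D + E)%N ->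
    size (flatten [seq Mword R z | z <- take j BL_blocks]) = block_start n Q T D E j.
  move=> jM; rewrite /BL_blocks /mkseq -map_take take_iota (minn_idPl (ltnW jM)).
  by rewrite (flatten_blocks W (blw_n B) (blw_E B) Mword_ST Mword_PQ) size_mkseq.
split=> -[j].
  rewrite size_mkseq => -[jM ->] [run_PQ end_ST]; exists j; first by rewrite startE.
  apply/(block_run (blw_n B) (blw_E B) ST_neq_PQ j s).
  by split=> [t /run_PQ|]; rewrite -nth_blocks.
move=> [jM ->] /(block_run (blw_n B) (blw_E B) ST_neq_PQ j s)[run_PQ end_ST].
exists j; first by rewrite size_mkseq startE.
by split=> [t /run_PQ|]; rewrite size_mkseq nth_blocks.
Qed.

(** Symbol 0 means that the residue at time i is smaller than k = nD.  Such a residue lies in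
    [0, D+E), so a word begins there, and the quotient by D is the number s of words W_{P/Q}. *)
Lemma BL_kneading_K0 i : (0 < i < b)%N ->
  kneading theta i.-1 = K0 <-> exists2 s, (s < n)%N & starts_string R PQ ST BL_blocks s i.
Proof.
move=> /andP[i_gt0 ib]; rewrite BL_kneading prednK //.
have D_gt0 := fw_D W.
have rotE j := rot_block_start W (blw_n B) (blw_E B) j.
transitivity (rot_orbit a b k i < k)%N.
  by case: ltngtP.
split=> [ri|[s sn /starts_string_blocks[j [jM ->]]]]; last first.
  by rewrite rotE => /andP[_ lt_s]; apply: leq_trans lt_s _; rewrite leq_mul2r sn orbT.
have riM : (rot_orbit a b k i < D + E)%N by apply: ltn_trans ri (k_lt_DE (blw_n B) (blw_E B)).
have D_lt : (D < D + E)%N by rewrite -[X in (X < _)%N]addn0 ltn_add2l.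
have [y] := rot_hit k D_lt (coprime_DE BL_coprime) 0 riM.
rewrite add0n => yE; pose j := (y %% (D + E))%N.
have jM : (j < D + E)%N by rewrite ltn_mod addn_gt0 D_gt0.
have jE : block_pos n D E j = rot_orbit a b k i.
  rewrite -yE; apply/eqP; rewrite /block_pos rot_orbit_eq ?(coprime_DE BL_coprime) //.
  by rewrite modn_mod.
have iE : i = block_start n Q T D E j.
  have jb : (block_start n Q T D E j < b)%N.
    rewrite -(block_start_total (blw_E B) BL_coprime).
    exact: (block_start_mono W (blw_n B) (blw_E B)).
  have /eqP := rotE j; rewrite jE rot_orbit_eq ?BL_lt ?BL_coprime //.
  by rewrite !modn_small // => /eqP.
exists (rot_orbit a b k i %/ D)%N; first by rewrite ltn_divLR.
by apply/starts_string_blocks; exists j => //; rewrite jE leq_divM ltn_ceil.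
Qed.

End BrokenLine.

Lemma BL_neighbors_unique (n n' : nat) (PQ ab ST PQ' ST' : rat)
    (P Q S T D E P' Q' S' T' D' E' : nat) :
  BL_weights n PQ ab ST P Q S T D E -> BL_weights n' PQ' ab ST' P' Q' S' T' D' E' ->
  (n * D = n' * D')%N -> PQ = PQ' /\ ST = ST'.
Proof.
move=> B B' nD.
have aE : (E * P + D * S = E' * P' + D' * S')%N.
  by apply/eqP; rewrite -eqz_nat -(blw_numab B) (blw_numab B').
have bE : (E * Q + D * T = E' * Q' + D' * T')%N.
  by apply/eqP; rewrite -eqz_nat -(blw_denab B) (blw_denab B').
have E0 : (0 < E)%N := leq_ltn_trans (leq0n _) (blw_E B).
have E0' : (0 < E')%N := leq_ltn_trans (leq0n _) (blw_E B').
have DD : D = D'.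
  have [lt_D|lt_D|//] := ltngtP D D'.
    have := threshold_lt (blw_farey B') (blw_farey B) (blw_n B') (blw_n B) (blw_E B)
      (esym aE) (esym bE) lt_D E0'.
    by rewrite nD ltnn.
  have := threshold_lt (blw_farey B) (blw_farey B') (blw_n B) (blw_n B') (blw_E B')
    aE bE lt_D E0.
  by rewrite nD ltnn.
move: (B'); rewrite -DD in aE bE * => {}B'.
have [PP QQ SS TT] := farey_weights_unique (blw_farey B) (blw_farey B') E0 E0' aE bE (BL_coprime B).
split; rewrite -[LHS]divq_num_den -[RHS]divq_num_den.
  by rewrite (blw_numPQ B) (blw_denPQ B) (blw_numPQ B') (blw_denPQ B') PP QQ.
by rewrite (blw_numST B) (blw_denST B) (blw_numST B') (blw_denST B') SS TT.
Qed.

Lemma BL_kneading_inj (R : realType) (n n' : nat) (PQ ab ST PQ' ab' ST' : rat)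
    (P Q S T D E P' Q' S' T' D' E' : nat) :
  BL_weights n PQ ab ST P Q S T D E -> BL_weights n' PQ' ab' ST' P' Q' S' T' D' E' ->
  kneading (BL_theta R PQ ab n) =1 kneading (BL_theta R PQ' ab' n') ->
  ab = ab' /\ (n * D = n' * D')%N.
Proof.
move=> B B' KK.
have /andP[k0 ka] := BL_threshold B; have /andP[k0' ka'] := BL_threshold B'.
have ab_lt := BL_lt B; have ab_lt' := BL_lt B'.
have cop := BL_coprime B; have cop' := BL_coprime B'.
have starE i : (E * Q + D * T %| i.+1)%N = (E' * Q' + D' * T' %| i.+1)%N.
  apply/idP/idP => [/(BL_kneading_star R B)|/(BL_kneading_star R B')].
    by rewrite KK => /(BL_kneading_star R B').
  by rewrite -KK => /(BL_kneading_star R B).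
have bE : (E * Q + D * T = E' * Q' + D' * T')%N.
  apply/eqP; rewrite eqn_dvd.
  have b_gt0 : (0 < E * Q + D * T)%N by apply: leq_ltn_trans ab_lt.
  have b_gt0' : (0 < E' * Q' + D' * T')%N by apply: leq_ltn_trans ab_lt'.
  by rewrite -(prednK b_gt0') starE prednK // dvdnn -(prednK b_gt0) -starE prednK // dvdnn.
have K0E x : (0 < x)%N -> (rot_orbit (E * P + D * S) (E * Q + D * T) (n * D) x < n * D)%N =
    (rot_orbit (E' * P' + D' * S') (E * Q + D * T) (n' * D') x < n' * D')%N.
  case: x => // x _.
  have := etrans (esym (BL_kneading R B x)) (etrans (KK x) (BL_kneading R B' x)).
  rewrite -bE.
  by case: ltngtP => _; case: ltngtP.
have KstarE x : (0 < x)%N -> (rot_orbit (E * P + D * S) (E * Q + D * T) (n * D) x == n * D)%N =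
    (rot_orbit (E' * P' + D' * S') (E * Q + D * T) (n' * D') x == n' * D')%N.
  case: x => // x _.
  have := etrans (esym (BL_kneading R B x)) (etrans (KK x) (BL_kneading R B' x)).
  rewrite -bE.
  by case: ltngtP => _; case: ltngtP.
have cop2 := cop'; have ab_lt2 := ab_lt'; rewrite -bE in cop2 ab_lt2.
have aE : (E * P + D * S = E' * P' + D' * S')%N.
  by apply: rot_coding_slope K0E KstarE => //; rewrite k0.
split.
  rewrite -[LHS]divq_num_den -[RHS]divq_num_den.
  by rewrite (blw_numab B) (blw_denab B) (blw_numab B') (blw_denab B') aE bE.
rewrite -aE in K0E ka'.
apply/eqP; rewrite eqn_leq; apply/andP; split.
  apply: (rot_coding_threshold ab_lt cop); first by rewrite k0 (ltn_trans ka).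
  by move=> x /K0E ->.
apply: (rot_coding_threshold ab_lt cop); first by rewrite k0' (ltn_trans ka').
by move=> x /K0E ->.
Qed.

Theorem theoremC (R : realType) (n : nat) (AB PQ ab ST : rat) :
  BL_data n AB PQ ab ST ->
  let alpha := BL_digits R PQ ab n in
  let theta := BL_theta R PQ ab n in
  let b := denn ab in
  [/\ (* the objects denoted in the statement exist *)
      (forall i : nat, alpha (i + b)%N = alpha i) /\
      (exists zeta : seq rat, Mdecomposition R PQ ab ST n zeta),
      0 < theta < 1 /\
      [/\ forall i : nat, kneading theta (i + b)%N = kneading theta i,
          kneading theta b.-1 = Kstar
        & forall i : nat, (1 <= i <= b.-1)%N -> kneading theta i.-1 <> Kstar],
      (* (a) *)
      (forall zeta : seq rat, Mdecomposition R PQ ab ST n zeta ->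
       forall i : nat, (1 <= i <= b.-1)%N ->
         (kneading theta i.-1 = K0 <->
          exists2 s : nat, (s < n)%N & starts_string R PQ ST zeta s i))
    & (* (b) *)
      (forall (n' : nat) (AB' PQ' ab' ST' : rat),
       BL_data n' AB' PQ' ab' ST' ->
       kneading theta =1 kneading (BL_theta R PQ' ab' n') ->
       [/\ PQ = PQ', ST = ST', ab = ab',
           alpha =1 BL_digits R PQ' ab' n'
         & theta = BL_theta R PQ' ab' n'])].
Proof.
move=> data alpha theta b; have [P [Q [S [T [D [E B]]]]]] := BL_data_weights data.
have bE : b = (E * Q + D * T)%N := BL_denn B.
have b_gt0 : (0 < b)%N by rewrite bE; apply: leq_ltn_trans (BL_lt B).
have rot_period x : rot_orbit (E * P + D * S) b (n * D) (x + b) =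
    rot_orbit (E * P + D * S) b (n * D) x.
  by rewrite /rot_orbit mulnDr addnA addnC modnMDl.
split.
- split; last by exists (BL_blocks n PQ ST D E); exact: (BL_blocksP R B).
  by move=> i; rewrite /alpha !(BL_digitsE R B) /rot_digits -bE -addSn rot_period.
- have /andP[_ ka] := BL_threshold B.
  split.
    rewrite /theta (BL_thetaE R B).
    by rewrite orbit_value_gt0 ?orbit_value_lt1 ?(BL_lt B) ?(BL_coprime B).
  split=> [i||i /andP[i_gt0 ib]].
  + by rewrite /theta !(BL_kneading R B) -bE -addSn rot_period.
  + by apply/(BL_kneading_star R B); rewrite prednK // bE.
  + move/(BL_kneading_star R B); rewrite prednK // -bE => /(dvdn_leq i_gt0); lia.
- move=> zeta /(BL_blocks_unique B) -> i /andP[i_gt0 ib].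
  by apply: (BL_kneading_K0 R B); rewrite i_gt0 -bE; lia.
- move=> n' AB' PQ' ab' ST' data' KK.
  have [P' [Q' [S' [T' [D' [E' B']]]]]] := BL_data_weights data'.
  have [abE kE] := BL_kneading_inj B B' KK; rewrite -abE in B' *.
  have [PQE STE] := BL_neighbors_unique B B' kE.
  have digitsE : alpha =1 BL_digits R PQ' ab n'.
    move=> i; rewrite /alpha (BL_digitsE R B) (BL_digitsE R B') -kE.
    congr rot_digits; apply/eqP; rewrite -eqz_nat.
      by rewrite -(blw_numab B) (blw_numab B').
    by rewrite -(blw_denab B) (blw_denab B').
  exact: (And5 PQE STE erefl digitsE (congr1 (@binary_number R) (funext digitsE))).
Qed.
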